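(* Let $T$ be a countable tree with all vertex degrees $\ge3$, $P$ a stochastic nearest-neighbour transition matrix on $T$ invariant under a group $\Gamma\le\mathrm{Aut}(T)$ acting transitively on vertices, with orbit data $I,p_j,-j,d_j$ as below, and assume $\sum_{j\in I}d_jp_{-j}<\infty$. Let $\kappa=\max\{2\sqrt{p_jp_{-j}}:j\in I\}$, $\mathcal U=\{\lambda\in\mathbb C:|\lambda|>\rho\}\setminus\{\pm it:\rho<t\le\kappa\}$ and $\mathcal W=\mathbb C\setminus\{\pm it:t\ge1/\kappa\}$. Define $$\Phi(t)=1+\sum_{j\in I}\frac{d_j}{2}\Bigl(\sqrt{1+4p_jp_{-j}t^2}-1\Bigr).$$ Then $\Phi$ is analytic on $\mathcal W$, and for all $\lambda\in\mathcal U$, $\lambda\,G(\lambda)=\Phi(G(\lambda))$. Furthermore $\rho=\min\{\Phi(t)/t:t>0\}=\Phi(\theta)/\theta$, where $\theta$ is the unique positive real solution of $\Phi'(t)=\Phi(t)/t$.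
   Context: Nearest-neighbour stochastic: $p(x,y)>0$ iff $x\sim y$, rows sum to $1$; invariance: $p(\gamma x,\gamma y)=p(x,y)$. $I$ is the set of $\Gamma$-orbits on oriented edges; for $j\in I$ the orbit of $(x,y)$: $p_j=p(x,y)$, $-j$ the orbit of $(y,x)$, $d_j$ the number of neighbours $y$ of a fixed vertex $x$ with $(x,y)\in j$. With root $o$ and $\mathsf m(x)=\prod_{i=1}^k p(x_{i-1},x_i)/p(x_i,x_{i-1})$ along $\pi(o,x)=[x_0,\dots,x_k]$, $P$ is self-adjoint on $\ell^2(T,\mathsf m)$; $\rho$ is its spectral radius, $\rho=\limsup_n p^{(n)}(x,y)^{1/n}$. $G(\lambda)=((\lambda I-P)^{-1}\mathbf 1_x)(x)$ (independent of $x$) for $\lambda$ in the resolvent set. Square roots use the principal branch on $\mathbb C\setminus(-\infty,0]$. *)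

(* Defs.v *)
From Stdlib Require Import Reals.
From Coquelicot Require Import Coquelicot.
From mathcomp Require Import ssreflect ssrfun ssrbool eqtype ssrnat seq choice path.

Set Implicit Arguments.
Unset Strict Implicit.
Unset Printing Implicit Defensive.

Open Scope R_scope.

Section TreeDefs.
Variable V : countType.

Definition enum_term (f : V -> R) (n : nat) : R :=
  match @pickle_inv V n with Some y => f y | None => 0 end.
Definition vsum (f : V -> R) : R := Series (enum_term f).

Definition enum_termC (f : V -> C) (n : nat) : C :=
  match @pickle_inv V n with Some y => f y | None => RtoC 0 end.
Definition CSeries (a : nat -> C) : C :=
  (Series (fun n => Re (a n)), Series (fun n => Im (a n))).

Definition simple_path (adj : rel V) (x y : V) (s : seq V) : bool :=
  [&& path adj x s, last x s == y & uniq (x :: s)].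

Definition is_tree (adj : rel V) : Prop :=
  (forall x y, adj x y = adj y x) /\ (forall x, ~~ adj x x) /\
  (forall x y, exists! s, simple_path adj x y s).

Definition min_degree3 (adj : rel V) : Prop :=
  forall x, exists a b c, [/\ adj x a, adj x b, adj x c & [/\ a <> b, a <> c & b <> c]].

Definition nn_stochastic (adj : rel V) (p : V -> V -> R) : Prop :=
  (forall x y, 0 <= p x y) /\ (forall x y, 0 < p x y <-> adj x y) /\
  (forall x, is_series (enum_term (p x)) 1).

Definition is_aut (adj : rel V) (g : V -> V) : Prop :=
  bijective g /\ forall x y, adj (g x) (g y) = adj x y.

Definition aut_subgroup (adj : rel V) (Gam : (V -> V) -> Prop) : Prop :=
  (forall g, Gam g -> is_aut adj g) /\ Gam id /\
  (forall g h, Gam g -> Gam h -> Gam (g \o h)) /\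
  (forall g, Gam g -> exists h, Gam h /\ cancel g h /\ cancel h g).

Definition vertex_transitive (Gam : (V -> V) -> Prop) : Prop :=
  forall x y, exists g, Gam g /\ g x = y.

Definition p_invariant (Gam : (V -> V) -> Prop) (p : V -> V -> R) : Prop :=
  forall g x y, Gam g -> p (g x) (g y) = p x y.

Fixpoint pn (p : V -> V -> R) (n : nat) (x y : V) : R :=
  match n with
  | O => if x == y then 1 else 0
  | S m => vsum (fun z => p x z * pn p m z y)
  end.

Definition rootn (a : R) (n : nat) : R :=
  if Rle_dec a 0 then 0 else Rpower a (/ INR n).

Definition spec_rad (p : V -> V -> R) (o : V) : R :=
  real (LimSup_seq (fun n => rootn (pn p n o o) n)).

Definition Gterm (p : V -> V -> R) (o : V) (l : C) (n : nat) : C :=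
  Cdiv (RtoC (pn p n o o)) (pow_n (K := C_Ring) l (S n)).

(* ---- principal square root on C \ (-oo,0] ---- *)
Definition Csqrt (z : C) : C :=
  (sqrt ((Cmod z + Re z) / 2),
   (if Rlt_dec (Im z) 0 then -1 else 1) * sqrt ((Cmod z - Re z) / 2)).

(* Phi(t) = 1 + sum_{j in I} d_j/2 (sqrt(1 + 4 p_j p_{-j} t^2) - 1),
   the orbit sum written as the sum over the neighbours y of o
   (edge (o,y) in orbit j: p_j = p o y, p_{-j} = p y o, and exactly d_j
   neighbours y give the orbit j). *)
Definition Phi (adj : rel V) (p : V -> V -> R) (o : V) (t : C) : C :=
  Cplus (RtoC 1) (CSeries (enum_termC (fun y =>
    if adj o y then
      Cmult (RtoC (/ 2))
        (Cminus (Csqrt (Cplus (RtoC 1) (Cmult (RtoC (4 * p o y * p y o)) (Cmult t t))))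
                (RtoC 1))
    else RtoC 0))).

End TreeDefs.

Definition analytic_on (W : C -> Prop) (f : C -> C) : Prop :=
  forall z0, W z0 -> exists r, 0 < r /\ exists a : nat -> C,
    forall z, Cmod (Cminus z z0) < r ->
      is_pseries (K := C_AbsRing) (V := C_NormedModule) a (Cminus z z0) (f z).

(* Main.v *)
(** For adjacent [o] and [y], splitting walks at their entrances into [o] (on a
    tree the branch of [y] is left only through the edge [(y,o)]) yields, for
    [X = p(o,y) G(y,o|l)], [c2 = p(o,y) p(y,o)] and the Green function [B] of the
    walk killed at [o], the equations [X (1 + X) = c2 G^2] and
    [X = c2 B^2 (1 + X)].  At real [r > rho] the second one forces
    [c2 B(r)^2 < 1]; since [B] has nonnegative coefficients,
    [|c2 B(l)^2| <= c2 B(|l|)^2 < 1] whenever [|l| > rho], so [|X| < |1 + X|],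
    that is [Re (1 + 2 X) > 0].  Hence [1 + 2 X] is the principal square root of
    [1 + 4 c2 G^2], and summing [X] over the neighbours of [o] gives
    [l G = Phi(G)] for all [|l| > rho], without analytic continuation.

    Conversely, for every [t > 0] the products along geodesics of the ratios
    [F(x,y) = X / (p(y,x) t)], with [X] the positive root of
    [X (1 + X) = c2 t^2], form a positive function [f] with
    [P f <= (Phi(t)/t) f], so [rho <= Phi(t)/t].  Convexity of [Phi] shows that
    the critical value [Phi(theta)/theta] is at most [Phi(t)/t] at [t = G(r)],
    which equals [r], for every [r > rho]; so it equals [rho]. *)

Require Import Defs.
From Stdlib Require Import Reals Lra Lia.
From Coquelicot Require Import Coquelicot.
From mathcomp Require Import ssreflect ssrfun ssrbool eqtype ssrnat seq choice path.
Open Scope R_scope.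

Set Implicit Arguments.
Unset Strict Implicit.

(** * Real series *)

(** The working variable is [z = 1/l]: if [a(z)] generates the return probabilities, then
    [G = z a(z)]. Vertices may have infinitely many neighbours, so a sum over neighbours is a
    genuine series, and each interchange with a sum over walk lengths or Taylor degrees needs a
    majorant. The edge equations come from decomposing both orientations of an edge at once:
    transitivity gives both ends the same [a(z)], which forces the two unknowns to coincide and
    turns a system into one quadratic equation. For analyticity, expanding each square root is not
    enough: the radius must be common to all neighbours and the coefficients bounded by a multiple
    of the summable weight [w = 4 p(o,y) p(y,o)]. Hence the coefficients are produced by the
    recursion for the root of [1 + b h + g h^2], which has an explicit majorant. The critical point
    is read off from [2 (t Phi' - Phi + 1)], the sum of [1 - 1/sqrt(1 + w t^2)] over the neighbours.
    It is 0 at 0, increases strictly, and each term tends to 1; theta is where it equals 2, a value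
    that three neighbours reach and two would not. *)

Lemma Series_const0 : Series (fun=> 0) = 0.
Proof.
rewrite -[RHS](Rmult_0_l (Series (fun=> 0))) -Series_scal_l.
by apply: Series_ext => n; rewrite Rmult_0_l.
Qed.

Lemma ex_series_abs_le (a b : nat -> R) :
  (forall n, Rabs (a n) <= b n) -> ex_series b -> ex_series a.
Proof. by move=> H; apply: (ex_series_le (V := R_CompleteNormedModule)). Qed.

Lemma Series_abs_le (a b : nat -> R) :
  (forall n, Rabs (a n) <= b n) -> ex_series b -> Rabs (Series a) <= Series b.
Proof.
move=> H Hb.
have Ha : ex_series (fun n => Rabs (a n)).
  by apply: ex_series_abs_le Hb => n; rewrite Rabs_Rabsolu.
apply: Rle_trans (Series_Rabs _ Ha) _; apply: Series_le => // n.
by split; [exact: Rabs_pos | exact: H].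
Qed.

Lemma Series_ge0 (a : nat -> R) :
  (forall n, 0 <= a n) -> ex_series a -> 0 <= Series a.
Proof.
move=> H Ha; apply: Rle_trans (Rabs_pos (Series a)) _.
by apply: Series_abs_le => // n; rewrite Rabs_pos_eq //; lra.
Qed.

Lemma Series_mono (a b : nat -> R) :
  (forall n, a n <= b n) -> ex_series a -> ex_series b -> Series a <= Series b.
Proof.
move=> H Ha Hb.
have : 0 <= Series (fun n => b n - a n).
  by apply: Series_ge0 => [n|]; [move: (H n); lra | apply: ex_series_minus].
rewrite Series_minus //; lra.
Qed.

Lemma sum_n_le_Series (a : nat -> R) N :
  (forall n, 0 <= a n) -> ex_series a -> sum_n a N <= Series a.
Proof.
move=> H Ha; rewrite (Series_incr_n _ N.+1) //; last by lia.
rewrite sum_n_Reals /=.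
have : 0 <= Series (fun k => a (N.+1 + k)%coq_nat).
  apply: Series_ge0 => [n|]; first exact: H.
  by apply/(ex_series_incr_n (V := R_NormedModule) a).
rewrite /=; lra.
Qed.

Lemma sum_n_ge0 (a : nat -> R) N : (forall n, 0 <= a n) -> 0 <= sum_n a N.
Proof.
move=> H; elim: N => [|N IH]; first by rewrite sum_O.
by rewrite sum_Sn /plus /=; move: (H N.+1); lra.
Qed.

Lemma term_le_Series (a : nat -> R) N :
  (forall n, 0 <= a n) -> ex_series a -> a N <= Series a.
Proof.
move=> H Ha; apply: Rle_trans (sum_n_le_Series N H Ha).
case: N => [|N]; first by rewrite sum_O; lra.
rewrite sum_Sn /plus /=.
have := sum_n_ge0 N H; lra.
Qed.

Lemma is_lim_seq_sum_n (f : nat -> nat -> R) (g : nat -> R) K :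
  (forall i, is_lim_seq (fun N => f N i) (g i)) ->
  is_lim_seq (fun N => sum_n (f N) K) (sum_n g K).
Proof.
move=> H; elim: K => [|K IH].
  rewrite sum_O; apply: is_lim_seq_ext (H 0%nat) => N; by rewrite sum_O.
rewrite sum_Sn.
apply: (is_lim_seq_ext (fun N => sum_n (f N) K + f N K.+1)).
  by move=> N; rewrite sum_Sn.
exact: is_lim_seq_plus'.
Qed.

(** Dominated convergence: one index [K] makes the tails of all the series small through the tail of
    [M], and below [K] only finitely many pointwise limits are involved. *)
Lemma is_lim_seq_Series_dominated (f : nat -> nat -> R) (g M : nat -> R) :
  (forall N i, Rabs (f N i) <= M i) -> ex_series M ->
  (forall i, is_lim_seq (fun N => f N i) (g i)) ->
  is_lim_seq (fun N => Series (f N)) (Series g).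
Proof.
move=> Hf HM Hlim.
have Hg i : Rabs (g i) <= M i.
  have H := is_lim_seq_abs _ _ (Hlim i).
  exact: (is_lim_seq_le _ (fun=> M i) _ _ (Hf ^~ i) H (is_lim_seq_const _)).
have exf N : ex_series (f N) by apply: ex_series_abs_le HM => i.
have exg : ex_series g by apply: ex_series_abs_le HM => i.
apply/is_lim_seq_spec => eps.
(* The head and the two tails cost less than [eps / 4] each. *)
have eps4 : 0 < eps / 4 by move: (cond_pos eps); lra.
have /is_lim_seq_spec/(_ (mkposreal _ eps4)) [K /(_ K (le_n _)) HK] :
    is_lim_seq (sum_n M) (Series M) by exact: Series_correct.
have /is_lim_seq_spec/(_ (mkposreal _ eps4)) [N0 HN0] :
    is_lim_seq (fun N => sum_n (f N) K) (sum_n g K) by exact: is_lim_seq_sum_n.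
exists N0 => N /HN0 /= HN.
have tail (a : nat -> R) : ex_series a ->
    Series a = sum_n a K + Series (fun k => a (K.+1 + k)%coq_nat).
  move=> Ha; rewrite (Series_incr_n _ K.+1) //; last by lia.
  by rewrite sum_n_Reals.
have tailb (a : nat -> R) : (forall i, Rabs (a i) <= M i) ->
    Rabs (Series (fun k => a (K.+1 + k)%coq_nat)) <=
    Series (fun k => M (K.+1 + k)%coq_nat).
  move=> Ha; apply: Series_abs_le => [k|]; first exact: Ha.
  by apply/(ex_series_incr_n (V := R_NormedModule) M).
move: HK; rewrite /= (tail M HM) => HK.
have := tailb _ (Hf N); have := tailb _ Hg.
rewrite (tail _ (exf N)) (tail _ exg).
move: HK HN; split_Rabs; lra.
Qed.

Lemma ex_series_sum_n (f : nat -> nat -> R) N :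
  (forall j, ex_series (fun i => f i j)) -> ex_series (fun i => sum_n (f i) N).
Proof.
move=> H; elim: N => [|N IH].
  by apply: ex_series_ext (H 0%nat) => i; rewrite sum_O.
apply: (ex_series_ext (fun i => sum_n (f i) N + f i N.+1)).
  by move=> i; rewrite sum_Sn.
exact: (ex_series_plus (V := R_NormedModule)).
Qed.

Lemma Series_sum_n (f : nat -> nat -> R) N :
  (forall j, ex_series (fun i => f i j)) ->
  Series (fun i => sum_n (f i) N) = sum_n (fun j => Series (fun i => f i j)) N.
Proof.
move=> H; elim: N => [|N IH].
  by rewrite sum_O; apply: Series_ext => i; rewrite sum_O.
rewrite sum_Sn -IH /plus /= -Series_plus //; last exact: ex_series_sum_n.
by apply: Series_ext => i; rewrite sum_Sn.
Qed.

Lemma Rabs_sum_n_le (a : nat -> R) N :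
  Rabs (sum_n a N) <= sum_n (fun n => Rabs (a n)) N.
Proof.
elim: N => [|N IH]; first by rewrite !sum_O; lra.
rewrite !sum_Sn /plus /=; move: IH; split_Rabs; lra.
Qed.

(** Fubini by dominated convergence: the partial row sums up to [N] are bounded by [M i] uniformly
    in [N]. The conclusion is an [is_series], so convergence of the series of column sums is part of
    it. *)
Lemma is_series_exchange (f : nat -> nat -> R) (M : nat -> R) :
  (forall i, ex_series (fun j => Rabs (f i j))) ->
  (forall i, Series (fun j => Rabs (f i j)) <= M i) -> ex_series M ->
  is_series (fun j => Series (fun i => f i j)) (Series (fun i => Series (f i))).
Proof.
move=> Hrow Hb HM.
have Hterm i j : Rabs (f i j) <= M i.
  apply: Rle_trans (Hb i).
  by apply: (term_le_Series (a := fun j => Rabs (f i j))) => // n; exact: Rabs_pos.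
have Hcol j : ex_series (fun i => f i j) by apply: ex_series_abs_le HM => i.
have H : is_lim_seq (fun N => Series (fun i => sum_n (f i) N))
           (Series (fun i => Series (f i))).
  apply: (is_lim_seq_Series_dominated (M := M)) => // [N i|i].
    apply: Rle_trans (Rabs_sum_n_le _ _) _; apply: Rle_trans (Hb i).
    by apply: sum_n_le_Series => // n; exact: Rabs_pos.
  exact: (Series_correct _ (ex_series_Rabs _ (Hrow i))).
by apply: filterlim_ext H => N; rewrite Series_sum_n.
Qed.

(** * Complex series *)

Lemma is_series_C (a : nat -> C) (l : C) :
  is_series (K := C_AbsRing) (V := C_NormedModule) a l <->
  is_series (fun n => Re (a n)) (Re l) /\ is_series (fun n => Im (a n)) (Im l).
Proof.
have S N : @sum_n C_AbelianGroup a N =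
           (sum_n (fun n => Re (a n)) N, sum_n (fun n => Im (a n)) N).
  elim: N => [|N IH]; first by rewrite !sum_O; case: (a 0%nat).
  by rewrite !sum_Sn IH; case: (a N.+1).
split=> [H|[H1 H2]].
  split; apply/filterlim_locally => eps;
  move/filterlim_locally/(_ eps): H; apply: filter_imp => N; rewrite S; by case.
apply/filterlim_locally => eps.
move/filterlim_locally/(_ eps): H1 => H1; move/filterlim_locally/(_ eps): H2 => H2.
by apply: filter_imp (filter_and _ _ H1 H2) => N; rewrite S.
Qed.

Definition Cabs_summable (a : nat -> C) := ex_series (fun n => Cmod (a n)).

Lemma Im_le_Cmod (z : C) : Rabs (Im z) <= Cmod z.
Proof. exact: Rle_trans (Rmax_r _ _) (Rmax_Cmod z). Qed.

Lemma Cabs_summable_Re a : Cabs_summable a -> ex_series (fun n => Rabs (Re (a n))).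
Proof.
apply: ex_series_abs_le => n; rewrite Rabs_Rabsolu; exact: re_le_Cmod.
Qed.

Lemma Cabs_summable_Im a : Cabs_summable a -> ex_series (fun n => Rabs (Im (a n))).
Proof.
apply: ex_series_abs_le => n; rewrite Rabs_Rabsolu; exact: Im_le_Cmod.
Qed.

Lemma Cabs_summable_le (a : nat -> C) (b : nat -> R) :
  (forall n, Cmod (a n) <= b n) -> ex_series b -> Cabs_summable a.
Proof.
move=> H; apply: ex_series_abs_le => n.
by rewrite Rabs_pos_eq //; exact: Cmod_ge_0.
Qed.

Lemma CSeries_correct (a : nat -> C) : Cabs_summable a ->
  is_series (K := C_AbsRing) (V := C_NormedModule) a (CSeries a).
Proof.
move=> H; apply/is_series_C; split; apply: Series_correct; apply: ex_series_Rabs.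
  exact: Cabs_summable_Re.
exact: Cabs_summable_Im.
Qed.

Lemma is_series_C_unique (a : nat -> C) (l : C) :
  is_series (K := C_AbsRing) (V := C_NormedModule) a l -> CSeries a = l.
Proof.
move=> /is_series_C[/is_series_unique H1 /is_series_unique H2].
by rewrite /CSeries H1 H2; case: l {H1 H2}.
Qed.

Lemma CSeries_ext (a b : nat -> C) :
  (forall n, a n = b n) -> CSeries a = CSeries b.
Proof. by move=> H; congr pair; apply: Series_ext => n; rewrite H. Qed.

Lemma CSeries_plus (a b : nat -> C) : Cabs_summable a -> Cabs_summable b ->
  CSeries (fun n => Cplus (a n) (b n)) = Cplus (CSeries a) (CSeries b).
Proof.
move=> /CSeries_correct Ha /CSeries_correct Hb.
exact: is_series_C_unique (is_series_plus _ _ _ _ Ha Hb).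
Qed.

Lemma CSeries_scal (c : C) (a : nat -> C) : Cabs_summable a ->
  CSeries (fun n => Cmult c (a n)) = Cmult c (CSeries a).
Proof.
move=> /CSeries_correct Ha.
exact: is_series_C_unique (is_series_scal_l (K := C_AbsRing) (V := C_NormedModule) c _ _ Ha).
Qed.

Lemma Cabs_summable_scal (c : C) (a : nat -> C) : Cabs_summable a ->
  Cabs_summable (fun n => Cmult c (a n)).
Proof.
move=> Ha; apply: (Cabs_summable_le (b := fun n => Cmod c * Cmod (a n))).
  by move=> n; rewrite Cmod_mult; lra.
exact: (ex_series_scal_l (K := R_AbsRing)).
Qed.

Lemma CSeries_RtoC (a : nat -> R) :
  CSeries (fun n => RtoC (a n)) = RtoC (Series a).
Proof.
by rewrite /CSeries /RtoC /= Series_const0.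
Qed.

(* A complex number of modulus m is rotated to the real axis, where the real
   triangle inequality applies. *)
Lemma Cmod_CSeries_le (a : nat -> C) (b : nat -> R) :
  (forall n, Cmod (a n) <= b n) -> ex_series b -> Cmod (CSeries a) <= Series b.
Proof.
move=> H Hb; have Ha := Cabs_summable_le H Hb.
set s := CSeries a.
case: (Req_dec (Cmod s) 0) => [-> | Hs].
  by apply: Series_ge0 => // n; apply: Rle_trans (Cmod_ge_0 _) (H n).
have E : Cmult (Cconj s) s = RtoC (Cmod s ^ 2) by rewrite Cmod2_conj Cmult_comm.
have E2 : Series (fun n => Re (Cmult (Cconj s) (a n))) = Cmod s ^ 2.
  have -> : Cmod s ^ 2 = Re (Cmult (Cconj s) s) by rewrite E.
  by rewrite {3}/s -CSeries_scal.
have : Cmod s ^ 2 <= Cmod s * Series b.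
  rewrite -E2 -Series_scal_l; apply: Rle_trans (Rle_abs _) _.
  apply: Series_abs_le => [n|].
    apply: Rle_trans (re_le_Cmod _) _; rewrite Cmod_mult Cmod_conj.
    by apply: Rmult_le_compat_l => //; exact: Cmod_ge_0.
  exact: (ex_series_scal_l (K := R_AbsRing)).
by have := Cmod_ge_0 s => ? ?; nra.
Qed.

Lemma CSeries_exchange (f : nat -> nat -> C) (M : nat -> R) :
  (forall i, Cabs_summable (f i)) ->
  (forall i, Series (fun j => Cmod (f i j)) <= M i) -> ex_series M ->
  is_series (K := C_AbsRing) (V := C_NormedModule)
    (fun j => CSeries (fun i => f i j)) (CSeries (fun i => CSeries (f i))).
Proof.
move=> Hrow Hb HM; apply/is_series_C; split => /=.
  apply: (is_series_exchange (M := M)) => // i; first exact: Cabs_summable_Re.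
  apply: Rle_trans (Hb i); apply: Series_le => [j|]; last exact: (Hrow i).
  by split; [exact: Rabs_pos | exact: re_le_Cmod].
apply: (is_series_exchange (M := M)) => // i; first exact: Cabs_summable_Im.
apply: Rle_trans (Hb i); apply: Series_le => [j|]; last exact: (Hrow i).
by split; [exact: Rabs_pos | exact: Im_le_Cmod].
Qed.

Lemma Re_sum_n (a : nat -> C) N :
  Re (@sum_n C_AbelianGroup a N) = sum_n (fun n => Re (a n)) N.
Proof. by elim: N => [|N IH]; rewrite ?sum_O // !sum_Sn -IH. Qed.

Lemma Im_sum_n (a : nat -> C) N :
  Im (@sum_n C_AbelianGroup a N) = sum_n (fun n => Im (a n)) N.
Proof. by elim: N => [|N IH]; rewrite ?sum_O // !sum_Sn -IH. Qed.

Definition Cconv (a b : nat -> C) (n : nat) : C :=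
  @sum_n C_AbelianGroup (fun k => Cmult (a k) (b (n - k)%coq_nat)) n.

Lemma is_series_Cconv (a b : nat -> C) : Cabs_summable a -> Cabs_summable b ->
  is_series (K := C_AbsRing) (V := C_NormedModule) (Cconv a b)
    (Cmult (CSeries a) (CSeries b)).
Proof.
move=> Ha Hb.
have P (u v : nat -> R) : ex_series (fun n => Rabs (u n)) ->
    ex_series (fun n => Rabs (v n)) ->
    is_series (fun n => sum_n (fun k => u k * v (n - k)%coq_nat) n)
      (Series u * Series v).
  move=> Hu Hv.
  have := is_series_mult u v _ _ (Series_correct _ (ex_series_Rabs _ Hu))
    (Series_correct _ (ex_series_Rabs _ Hv)) Hu Hv.
  by apply: is_series_ext => n; rewrite sum_n_Reals.
have [rA iA] := (Cabs_summable_Re Ha, Cabs_summable_Im Ha).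
have [rB iB] := (Cabs_summable_Re Hb, Cabs_summable_Im Hb).
apply/is_series_C; split.
  apply: is_series_ext (is_series_minus _ _ _ _ (P _ _ rA rB) (P _ _ iA iB)) => n.
  rewrite Re_sum_n /plus /opp /=.
  have K (u v : nat -> R) m : sum_n u m + - sum_n v m = sum_n (fun k => u k - v k) m.
    elim: m => [|m IH]; first by rewrite !sum_O.
    by rewrite !sum_Sn -IH /plus /=; lra.
  exact: K.
apply: is_series_ext (is_series_plus _ _ _ _ (P _ _ rA iB) (P _ _ iA rB)) => n.
by rewrite Im_sum_n -sum_n_plus.
Qed.

(** * Sums over a countable type *)

Lemma is_series_delta (m : nat) (c : R) :
  is_series (fun n => if n == m then c else 0) c.
Proof.
have S N : sum_n (fun n => if n == m then c else 0) N = if (m <= N)%N then c else 0.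
  elim: N => [|N IH]; first by rewrite sum_O leqn0 eq_sym.
  rewrite sum_Sn IH /plus /= -[(m <= N)%N]ltnS.
  by case: ltngtP => _ /=; lra.
apply/filterlim_locally => eps; exists m => N /leP mN; rewrite S mN.
exact: ball_center.
Qed.

Arguments is_series_delta : clear implicits.

Lemma is_series_deltaC (m : nat) (c : C) :
  is_series (K := C_AbsRing) (V := C_NormedModule)
    (fun n => if n == m then c else RtoC 0) c.
Proof.
apply/is_series_C; split.
  by apply: is_series_ext (is_series_delta m (Re c)) => n; case: eqP.
by apply: is_series_ext (is_series_delta m (Im c)) => n; case: eqP.
Qed.

Arguments is_series_deltaC : clear implicits.

Section CountableSums.
Variable V : countType.
Implicit Types (f g : V -> R) (x y : V).

Definition summable f := ex_series (enum_term f).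

Lemma enum_term_pickle f y : enum_term f (pickle y) = f y.
Proof. by rewrite /enum_term pickleK_inv. Qed.

(** Case split on an index, which is either the code of a vertex or no code at all. The predicate
    [Q] receives value and index together, so that both are rewritten at once. *)
Lemma enum_term_ind f (Q : R -> nat -> Prop) :
  (forall y, Q (f y) (pickle y)) -> (forall n, (forall y, n <> pickle y) -> Q 0 n) ->
  forall n, Q (enum_term f n) n.
Proof.
move=> H1 H0 n; rewrite /enum_term.
have := @pickle_invK V n; case E: (pickle_inv n) => [y|] /= => [<- //|_].
by apply: H0 => y En; move: E; rewrite En pickleK_inv.
Qed.

Lemma summable_le f g : (forall y, Rabs (f y) <= g y) -> summable g -> summable f.
Proof.
move=> H; apply: ex_series_abs_le; rewrite /enum_term => n.
by case: pickle_inv => [y|]; rewrite ?Rabs_R0; [exact: H | lra].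
Qed.

Lemma summable_plus f g : summable f -> summable g -> summable (fun y => f y + g y).
Proof.
move=> Hf Hg; apply: ex_series_ext (ex_series_plus (V := R_NormedModule) _ _ Hf Hg) => n.
by rewrite /plus /= /enum_term; case: pickle_inv => //; lra.
Qed.

Lemma summable_scal c f : summable f -> summable (fun y => c * f y).
Proof.
move=> Hf; apply: ex_series_ext (ex_series_scal_l (K := R_AbsRing) c _ Hf) => n.
by rewrite /scal /= /mult /= /enum_term; case: pickle_inv => //; lra.
Qed.

Lemma vsum_ext f g : (forall y, f y = g y) -> vsum f = vsum g.
Proof. by move=> H; apply: Series_ext => n; rewrite /enum_term; case: pickle_inv. Qed.

Lemma vsum_plus f g : summable f -> summable g ->
  vsum (fun y => f y + g y) = vsum f + vsum g.
Proof.
move=> Hf Hg; rewrite /vsum -Series_plus //; apply: Series_ext => n.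
by rewrite /enum_term; case: pickle_inv => //; lra.
Qed.

Lemma vsum_scal c f : vsum (fun y => c * f y) = c * vsum f.
Proof.
rewrite /vsum -Series_scal_l; apply: Series_ext => n.
by rewrite /enum_term; case: pickle_inv => //; lra.
Qed.

Lemma vsum_le f g : summable f -> summable g -> (forall y, f y <= g y) ->
  vsum f <= vsum g.
Proof.
move=> Hf Hg H; apply: Series_mono => // n.
by rewrite /enum_term; case: pickle_inv => //; lra.
Qed.

Lemma enum_term_ge0 f n : (forall y, 0 <= f y) -> 0 <= enum_term f n.
Proof. by move=> H; rewrite /enum_term; case: pickle_inv => //; lra. Qed.

Lemma vsum_ge0 f : (forall y, 0 <= f y) -> summable f -> 0 <= vsum f.
Proof. by move=> H; apply: Series_ge0 => n; exact: enum_term_ge0. Qed.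

Lemma vsum_term_le f y : (forall y, 0 <= f y) -> summable f -> f y <= vsum f.
Proof.
move=> H Hf; rewrite -{1}(enum_term_pickle f y); apply: term_le_Series => // n.
exact: enum_term_ge0.
Qed.

Lemma enum_term_delta x c n :
  enum_term (fun y => if y == x then c else 0) n = if n == pickle x then c else 0.
Proof.
apply: (enum_term_ind (Q := fun a n => a = if n == pickle x then c else 0)) => [y|m Hm]; last by case: eqP => // /Hm.
by rewrite (inj_eq (pcan_inj pickleK_inv)).
Qed.

Lemma is_series_vdelta x c :
  is_series (enum_term (fun y => if y == x then c else 0)) c.
Proof.
by apply: is_series_ext (is_series_delta (pickle x) c) => n; rewrite enum_term_delta.
Qed.

Arguments is_series_vdelta : clear implicits.

Lemma summable_delta x c : summable (fun y => if y == x then c else 0).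
Proof. by exists c; exact: is_series_vdelta. Qed.

Lemma vsum_delta x c : vsum (fun y => if y == x then c else 0) = c.
Proof. exact: is_series_unique (is_series_vdelta x c). Qed.

Lemma summable_sum_n (f : nat -> V -> R) N : (forall k, summable (f k)) ->
  summable (fun y => sum_n (fun k => f k y) N).
Proof.
move=> H; apply: ex_series_ext (ex_series_sum_n N H) => n.
rewrite /enum_term; case: pickle_inv => // .
by elim: N => [|N IH]; rewrite ?sum_O ?sum_Sn ?IH /plus //=; lra.
Qed.

Lemma vsum_sum_n (f : nat -> V -> R) N : (forall k, summable (f k)) ->
  vsum (fun y => sum_n (fun k => f k y) N) = sum_n (fun k => vsum (f k)) N.
Proof.
move=> H; rewrite /vsum -Series_sum_n //; apply: Series_ext => n.
rewrite /enum_term; case: pickle_inv => // .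
by elim: N => [|N IH]; rewrite ?sum_O ?sum_Sn -?IH /plus //=; lra.
Qed.

(** Invariance under reindexing, obtained from the exchange of sums instead of a rearrangement
    theorem. *)
Lemma vsum_bij f (s : V -> V) : (forall y, 0 <= f y) -> summable (fun y => f (s y)) ->
  bijective s -> vsum (fun y => f (s y)) = vsum f.
Proof.
move=> f0 Hfs [s' sK s'K].
(* A permutation matrix weighted by [f]: a row or column that belongs to a vertex has one possibly
   nonzero entry, so row sums give the reindexed series and column sums the original one. *)
pose a n m := match @pickle_inv V n with
  | Some x => if m == pickle (s x) then f (s x) else 0 | None => 0 end.
have rows n : is_series (a n) (enum_term (fun y => f (s y)) n).
  rewrite /a /enum_term; case: pickle_inv => [x|]; first exact: is_series_delta.
  by apply: is_series_ext (is_series_delta 0 0) => k; case: eqP.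
have a0 n m : 0 <= a n m.
  by rewrite /a; case: pickle_inv => [x|]; [case: eqP => // _|]; lra.
have cols m : is_series (fun n => a n m) (enum_term f m).
  apply: (enum_term_ind (Q := fun b m => is_series (fun n => a n m) b)) => [y|{}m Hm].
    apply: is_series_ext (is_series_delta (pickle (s' y)) (f y)) => n.
    rewrite /a; have := @pickle_invK V n.
    case E: (pickle_inv n) => [x|] /=; last first.
      by move=> _; case: eqP => // En; move: E; rewrite En pickleK_inv.
    move=> <-; rewrite !(inj_eq (pcan_inj pickleK_inv)).
    have -> : (y == s x) = (x == s' y).
      by apply/eqP/eqP => [->|->]; rewrite ?sK ?s'K.
    by case: eqP => // ->; rewrite s'K.
  apply: is_series_ext (is_series_delta 0 0) => n; rewrite /a.
  by case: pickle_inv => [x|]; case: eqP => // _; case: eqP => // /Hm.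
have aR n m : Rabs (a n m) = a n m by rewrite Rabs_pos_eq.
have H : is_series (fun m => Series (fun n => a n m)) (Series (fun n => Series (a n))).
  apply: (is_series_exchange (M := enum_term (fun y => f (s y)))) => // n.
    by apply: ex_series_ext (ex_intro _ _ (rows n)) => m; rewrite aR.
  rewrite (Series_ext _ _ (aR n)) (is_series_unique _ _ (rows n)); lra.
rewrite /vsum (Series_ext _ (fun n => Series (a n))); last first.
  by move=> n; rewrite (is_series_unique _ _ (rows n)).
rewrite -(is_series_unique _ _ H); apply: Series_ext => m.
exact: is_series_unique (cols m).
Qed.
End CountableSums.

(** * Taboo decomposition of walks on a tree *)

Lemma sum_n_Sl (f : nat -> R) n :
  sum_n f n.+1 = f 0%nat + sum_n (fun k => f k.+1) n.
Proof.
elim: n => [|n IH]; first by rewrite sum_Sn !sum_O.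
by rewrite sum_Sn IH sum_Sn /plus /=; lra.
Qed.

Section Chain.
Variables (V : countType) (adj : rel V) (p : V -> V -> R).
Hypotheses (tree : is_tree adj) (stoch : nn_stochastic adj p).

Lemma p_ge0 x y : 0 <= p x y. Proof. by case: stoch. Qed.

Lemma p_gt0 x y : adj x y -> 0 < p x y.
Proof. by case: stoch => _ [H _] /H. Qed.

Lemma p_eq0 x y : ~~ adj x y -> p x y = 0.
Proof.
case: stoch => H0 [H _] /negP nxy; case: (Rle_lt_or_eq_dec _ _ (H0 x y)) => //.
by move/H.
Qed.

Lemma adj_sym x y : adj x y = adj y x. Proof. by case: tree. Qed.

Lemma summable_p x : summable (p x).
Proof. by case: stoch => _ [_ H]; exists 1. Qed.

Lemma vsum_p x : vsum (p x) = 1.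
Proof. by case: stoch => _ [_ H]; exact: is_series_unique. Qed.

Lemma p_le1 x y : p x y <= 1.
Proof.
rewrite -(vsum_p x); apply: vsum_term_le; [exact: p_ge0 | exact: summable_p].
Qed.

Lemma summable_p_mult x (f : V -> R) : (forall y, Rabs (f y) <= 1) ->
  summable (fun y => p x y * f y).
Proof.
move=> H; apply: summable_le (summable_p x) => y.
rewrite Rabs_mult Rabs_pos_eq; last exact: p_ge0.
by have := p_ge0 x y; move: (H y); nra.
Qed.

Lemma pn_bounds n x y : 0 <= pn p n x y <= 1.
Proof.
elim: n x => [|n IH] x /=; first by case: eqP; lra.
have S : summable (fun z => p x z * pn p n z y).
  by apply: summable_p_mult => z; rewrite Rabs_pos_eq; case: (IH z).
split; first by apply: vsum_ge0 => // z; apply: Rmult_le_pos (p_ge0 _ _) _; case: (IH z).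
rewrite -(vsum_p x); apply: vsum_le => // [|z]; first exact: summable_p.
by have := p_ge0 x z; have := IH z; nra.
Qed.

Lemma summable_pn n x y : summable (fun z => p x z * pn p n z y).
Proof.
by apply: summable_p_mult => z; rewrite Rabs_pos_eq; case: (pn_bounds n z y).
Qed.

Lemma pn_step_le n x z y : p x z * pn p n z y <= pn p n.+1 x y.
Proof.
apply: (vsum_term_le (f := fun z => p x z * pn p n z y)) (summable_pn n x y) => w.
by apply: Rmult_le_pos (p_ge0 _ _) _; case: (pn_bounds n w y).
Qed.

Section Taboo.
Variables (o y : V).
Hypothesis oy : adj o y.

(** Weight of the walks of length [n] from [x] to [y] that never step into [o]; the starting vertex
    itself is not tested. *)
Fixpoint taboo n x : R :=
  match n with
  | O => if x == y then 1 else 0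
  | S m => vsum (fun w => if w == o then 0 else p x w * taboo m w)
  end.

Lemma taboo_bounds n x : 0 <= taboo n x <= pn p n x y.
Proof.
elim: n x => [|n IH] x /=; first by case: eqP; lra.
have B w : 0 <= (if w == o then 0 else p x w * taboo n w) <= p x w * pn p n w y.
  have := p_ge0 x w; have := IH w; have := pn_bounds n w y.
  by case: eqP => _; nra.
have S : summable (fun w => if w == o then 0 else p x w * taboo n w).
  apply: summable_le (summable_pn n x y) => w; rewrite Rabs_pos_eq; by case: (B w).
split; first by apply: vsum_ge0 => // w; case: (B w).
by apply: vsum_le => // [|w]; [exact: summable_pn | case: (B w)].
Qed.

Lemma summable_taboo n x : summable (fun w => if w == o then 0 else p x w * taboo n w).
Proof.
apply: summable_le (summable_p x) => w.
have := p_ge0 x w; have := taboo_bounds n w; have := pn_bounds n w y.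
by case: eqP => _ *; rewrite Rabs_pos_eq; nra.
Qed.

(** The component of [y] once [o] is deleted from the tree. The path need not be simple, which makes
    [branch_step] a mere extension at the end. *)
Definition branch x := exists s, [/\ path adj y s, last y s = x & o \notin y :: s].

Lemma branch_step x w : branch x -> adj x w -> w != o -> branch w.
Proof.
move=> [s [ps ls os]] xw wo; exists (rcons s w).
rewrite rcons_path ps ls last_rcons -rcons_cons mem_rcons inE negb_or eq_sym wo.
by split.
Qed.

(** The edge from [o] to [x] and the detour through [y] (with its loops removed) are both simple
    paths from [o] to [x], hence equal. *)
Lemma branch_adj x : branch x -> adj o x -> x = y.
Proof.
move=> [s [ps ls os]] ox; move: ls; case/shortenP: ps => s' ps' us' ss' ls'.
have [_ [irr /(_ o x)[t [_ U]]]] := tree.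
have : t = [:: x].
  apply: U; rewrite /simple_path /= ox eqxx /= inE andbT.
  by apply/eqP => E; move: ox; rewrite -E (negbTE (irr o)).
have -> : t = y :: s'.
  apply: U; rewrite /simple_path /= oy ps' /= ls' eqxx /=.
  move: us' => /= ->; rewrite andbT; move: os; rewrite !inE !negb_or => /andP[-> /=].
  by apply: contra => /ss'.
by case.
Qed.

Lemma branch_self : branch y.
Proof.
exists [::]; split=> //; rewrite inE; apply/eqP => E; move: oy; rewrite E.
by case: tree => _ [/(_ y)/negbTE ->].
Qed.

(* Last visit to [y] before the first entrance into [o]: inside the branch of
   [y], the vertex [o] can only be entered from [y]. *)
Lemma pn_taboo n x z : branch x -> z = o \/ z = y ->
  pn p n x z = (if z == y then taboo n x else 0) +
    match n with
    | O => 0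
    | S m => p y o * sum_n (fun k => taboo k x * pn p (m - k)%coq_nat o z) m
    end.
Proof.
move=> bx zE; elim: n x bx => [|n IH] x bx.
  rewrite /=; case: zE => ->; last by rewrite eqxx; lra.
  have -> : (x == o) = false.
    by apply/eqP => E; case: bx => s [_ ls]; rewrite -E -ls mem_last.
  by case: eqP => [E|_]; [move: oy; rewrite E; case: tree => _ [/(_ y)/negbTE ->] | lra].
pose c w := match n with
    | O => 0
    | S m => p y o * sum_n (fun k => taboo k w * pn p (m - k)%coq_nat o z) m
    end.
have S1 := summable_delta o (p x o * pn p n o z).
have S2 := summable_scal (if z == y then 1 else 0) (summable_taboo n x).
(* One more step inside the branch raises the taboo index from [k] to [k.+1]; the remaining factor
   does not depend on the vertex [w] and comes out of the sum. *)
have [S3 E3] : summable (fun w => if w == o then 0 else p x w * c w) /\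
    vsum (fun w => if w == o then 0 else p x w * c w) =
    match n with
    | O => 0
    | S m => p y o * sum_n (fun k => taboo k.+1 x * pn p (m - k)%coq_nat o z) m
    end.
  rewrite /c; case: n {IH c S1 S2} => [|m].
    split.
      by apply: summable_le (summable_p x) => w; case: eqP => _;
        rewrite ?Rmult_0_r Rabs_R0; exact: p_ge0.
    rewrite (vsum_ext (g := fun w => 0 * p x w)); first by rewrite vsum_scal; lra.
    by move=> w; case: eqP => _; lra.
  pose h k w := (p y o * pn p (m - k)%coq_nat o z) *
                (if w == o then 0 else p x w * taboo k w).
  have Sh k : summable (h k) by apply: summable_scal; exact: summable_taboo.
  have E w : (if w == o then 0 else p x w *
      (p y o * sum_n (fun k => taboo k w * pn p (m - k)%coq_nat o z) m)) =
      sum_n (fun k => h k w) m.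
    rewrite /h; case: (w == o).
      rewrite (sum_n_ext _ (fun=> 0)) => [|k]; last by rewrite Rmult_0_r.
      by rewrite sum_n_const Rmult_0_r.
    rewrite -Rmult_assoc -[LHS](sum_n_mult_l (K := R_Ring)).
    by apply: sum_n_ext => k; rewrite /mult /=; lra.
  split.
    by apply: ex_series_ext (summable_sum_n m Sh) => k; rewrite /enum_term;
      case: pickle_inv.
  rewrite (vsum_ext E) vsum_sum_n // -[RHS](sum_n_mult_l (K := R_Ring)).
  by apply: sum_n_ext => k; rewrite /h vsum_scal /mult /=; lra.
(* First-step analysis: the step enters [o], or it stays in the branch, where the induction
   hypothesis splits the rest into a taboo part and the convolution [c w]. *)
rewrite [LHS]/= (vsum_ext (g := fun w => ((if w == o then p x o * pn p n o z else 0) +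
  (if z == y then 1 else 0) * (if w == o then 0 else p x w * taboo n w)) +
  (if w == o then 0 else p x w * c w))); last first.
  move=> w; case: (w =P o) => [->|/eqP wo]; first lra.
  case axw: (adj x w); last by rewrite (p_eq0 (negbT axw)); lra.
  by rewrite (IH w (branch_step bx axw wo)) -/(c w); case: (z == y); lra.
rewrite vsum_plus //; last exact: summable_plus.
rewrite vsum_plus // vsum_delta vsum_scal E3 -[vsum _]/(taboo n.+1 x).
(* The walk can enter [o] at once only from [x = y]. As [taboo 0 x] is the indicator of [x = y],
   this is the missing term [k = 0] of the convolution. *)
have -> : p x o = p y o * (if x == y then 1 else 0).
  case: eqP => [->|xy]; first lra.
  by rewrite p_eq0 ?Rmult_0_r // adj_sym; apply/negP => /(branch_adj bx).
case: n {IH c S1 S2 S3 E3} => [|m]; first by rewrite sum_O /=; case: (z == y); lra.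
by rewrite sum_n_Sl; case: (z == y); rewrite /=; lra.
Qed.

Lemma pn_to_root n :
  pn p n.+1 y o = p y o * sum_n (fun k => taboo k y * pn p (n - k)%coq_nat o o) n.
Proof.
rewrite (pn_taboo n.+1 branch_self (or_introl erefl)).
case: eqP => [E|_]; last by rewrite Rplus_0_l.
by move: oy; rewrite E; case: tree => _ [/(_ y)/negbTE ->].
Qed.

Lemma pn_to_self n : pn p n.+1 y y =
  taboo n.+1 y + p y o * sum_n (fun k => taboo k y * pn p (n - k)%coq_nat o y) n.
Proof. by rewrite (pn_taboo n.+1 branch_self (or_intror erefl)) eqxx. Qed.

End Taboo.
End Chain.

(** * The principal square root *)

Lemma Csqrt_unique (w z : C) : 0 < Re w -> Cmult w w = z -> Csqrt z = w.
Proof.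
case: w => a b /= a0 <-.
have E : Cmod (Cmult (a, b) (a, b)) = a * a + b * b.
  by rewrite Cmod_mult -[_ * _]/(Rsqr _) /Cmod Rsqr_sqrt /=; nra.
rewrite /Csqrt E /= (_ : (_ + _ + _) / 2 = a * a); last lra.
rewrite (_ : (_ + _ - _) / 2 = b * b); last lra.
rewrite sqrt_square; last lra.
rewrite -[b * b]/(Rsqr b) sqrt_Rsqr_abs; congr pair.
(* [Im (w * w) = 2 a b] has the sign of [b] because [a > 0]; the case [b = 0] falls under the sign
   [+1]. *)
case: Rlt_dec => H /=.
  by have : b < 0; [nra | split_Rabs; lra].
by have : 0 <= b; [nra | split_Rabs; lra].
Qed.

Lemma Csqrt_sqr (z : C) : Cmult (Csqrt z) (Csqrt z) = z.
Proof.
have H1 : 0 <= (Cmod z + Re z) / 2 by have := re_le_Cmod z; split_Rabs; lra.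
have H2 : 0 <= (Cmod z - Re z) / 2 by have := re_le_Cmod z; split_Rabs; lra.
have E := Cmod2_alt z.
have S1 := sqrt_sqrt _ H1; have S2 := sqrt_sqrt _ H2.
(* The cross term of the square: the product of the two radicands is
   [(|z|^2 - (Re z)^2) / 4 = (Im z)^2 / 4]. *)
have P : sqrt ((Cmod z + Re z) / 2) * sqrt ((Cmod z - Re z) / 2) = Rabs (Im z) / 2.
  rewrite -sqrt_mult // -[RHS]sqrt_square; last by have := Rabs_pos (Im z); lra.
  congr sqrt; rewrite [RHS](_ : _ = (Rabs (Im z) * Rabs (Im z)) / 4); last field.
  by rewrite -Rabs_mult Rabs_pos_eq; nra.
rewrite /Csqrt; case: z H1 H2 E S1 S2 P => x y /= H1 H2 E S1 S2 P.
move: S1 S2 P; set s := sqrt _; set t := sqrt _ => S1 S2 P.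
rewrite /Cmult /=; case: Rlt_dec => H /=.
  by rewrite Rabs_left in P; [congr pair; nra | lra].
by rewrite Rabs_pos_eq in P; [congr pair; nra | lra].
Qed.

Lemma Csqrt_pos (x : R) : 0 <= x -> Csqrt (RtoC x) = RtoC (sqrt x).
Proof.
move=> x0; rewrite /Csqrt Cmod_R Rabs_pos_eq //= /RtoC; congr pair.
  by congr sqrt; lra.
by rewrite (_ : (x - x) / 2 = 0) ?sqrt_0; lra.
Qed.

(** * Generating functions *)

(* [ring] does not see through the Coquelicot structures on [R] and [C]. *)
Ltac ring_in T := match goal with |- @eq _ ?x ?y => change (@eq T x y); ring end.

Notation Cpow z n := (pow_n (K := C_Ring) z n).

Lemma Cpow_S (z : C) n : Cpow z n.+1 = Cmult z (Cpow z n).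
Proof. by []. Qed.

Lemma Cmod_Cpow (z : C) n : Cmod (Cpow z n) = Cmod z ^ n.
Proof.
elim: n => [|n IH]; first exact: Cmod_1.
by rewrite Cpow_S Cmod_mult IH.
Qed.

Lemma Cpow_RtoC (r : R) n : Cpow (RtoC r) n = RtoC (r ^ n).
Proof. by elim: n => [|n IH] //; rewrite Cpow_S IH -RtoC_mult. Qed.

Lemma Cpow_add (z : C) m n : Cpow z (m + n)%coq_nat = Cmult (Cpow z m) (Cpow z n).
Proof. exact: (pow_n_plus (K := C_Ring)). Qed.

Lemma CSeries_incr_1 (a : nat -> C) : Cabs_summable a ->
  CSeries a = Cplus (a 0%nat) (CSeries (fun n => a n.+1)).
Proof.
move=> Ha; rewrite /CSeries /Cplus /=; congr pair; apply: Series_incr_1;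
  apply: ex_series_Rabs; [exact: Cabs_summable_Re | exact: Cabs_summable_Im].
Qed.

Lemma Cabs_summable_incr_1 (a : nat -> C) : Cabs_summable a ->
  Cabs_summable (fun n => a n.+1).
Proof. by move=> Ha; apply/(ex_series_incr_1 (fun n => Cmod (a n))). Qed.

Definition gterm (b : nat -> R) (z : C) (n : nat) : C := Cmult (RtoC (b n)) (Cpow z n).
Definition gf (b : nat -> R) (z : C) : C := CSeries (gterm b z).

Lemma Cmod_gterm b z n : 0 <= b n -> Cmod (gterm b z n) = b n * Cmod z ^ n.
Proof. by move=> b0; rewrite Cmod_mult Cmod_R Cmod_Cpow Rabs_pos_eq. Qed.

Lemma gf_RtoC b r : gf b (RtoC r) = RtoC (Series (fun n => b n * r ^ n)).
Proof.
rewrite -CSeries_RtoC; apply: CSeries_ext => n.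
by rewrite /gterm Cpow_RtoC -RtoC_mult.
Qed.

Lemma RtoC_sum_n (u : nat -> R) N :
  RtoC (sum_n u N) = @sum_n C_AbelianGroup (fun k => RtoC (u k)) N.
Proof.
elim: N => [|N IH]; first by rewrite !sum_O.
by rewrite !sum_Sn -IH; exact: RtoC_plus.
Qed.

Lemma gterm_conv b c z n :
  Cconv (gterm b z) (gterm c z) n =
  gterm (fun n => sum_n (fun k => b k * c (n - k)%coq_nat) n) z n.
Proof.
rewrite /gterm RtoC_sum_n -[RHS](sum_n_mult_r (K := C_Ring)).
apply: sum_n_ext_loc => k kn.
have -> : Cpow z n = Cmult (Cpow z k) (Cpow z (n - k)%coq_nat).
  by rewrite -Cpow_add; congr pow_n; lia.
by rewrite /gterm /mult /= RtoC_mult; ring.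
Qed.

Lemma is_series_scal_Cconv (c : C) (a b : nat -> C) :
  Cabs_summable a -> Cabs_summable b ->
  is_series (K := C_AbsRing) (V := C_NormedModule) (fun n => Cmult c (Cconv a b n))
    (Cmult c (Cmult (CSeries a) (CSeries b))).
Proof.
move=> Ha Hb.
exact: (is_series_scal_l (K := C_AbsRing) (V := C_NormedModule) c _ _ (is_series_Cconv Ha Hb)).
Qed.

(** * Edge equations on the circle |z| = r, where z = 1/l *)

Section Green.
Variables (V : countType) (adj : rel V) (p : V -> V -> R).
Hypotheses (tree : is_tree adj) (stoch : nn_stochastic adj p).
Variable a : nat -> R.
Hypothesis diag : forall n x, pn p n x x = a n.
Variable r : R.
Hypotheses (r0 : 0 < r) (conv : ex_series (fun n => a n * r ^ n)).

Let ge0 := p_ge0 stoch.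
Let pnb := pn_bounds stoch.

Lemma ret_conv (x : V) z : Cmod z = r -> Cabs_summable (gterm (fun n => pn p n x x) z).
Proof.
move=> zr; apply: Cabs_summable_le conv => n.
by rewrite Cmod_gterm ?zr ?diag; [lra | rewrite -(diag n x); case: (pnb n x x)].
Qed.

Lemma taboo_conv o y z : Cmod z = r -> Cabs_summable (gterm (fun n => taboo p o y n y) z).
Proof.
move=> zr; apply: Cabs_summable_le conv => n.
have [t0 t1] := taboo_bounds stoch o y n y.
rewrite Cmod_gterm // zr -(diag n y); apply: Rmult_le_compat_r => //.
by apply: pow_le; lra.
Qed.

(** A step from [o] to [y] followed by a walk back is a return to [o], so
    [p o y * pn p n y o <= a n.+1]; dividing by [p o y * r] yields the majorant. *)
Lemma nbr_conv o y z : Cmod z = r -> adj o y ->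
  Cabs_summable (gterm (fun n => pn p n y o) z).
Proof.
move=> zr oy; have po := p_gt0 stoch oy.
apply: (@Cabs_summable_le _ (fun n => / (p o y * r) * (a n.+1 * r ^ n.+1))).
  move=> n; rewrite Cmod_gterm ?zr; last by case: (pnb n y o).
  have := pn_step_le stoch n o y o; rewrite diag => H.
  apply: (Rmult_le_reg_l (p o y * r)); first nra.
  rewrite -[X in _ <= X]Rmult_assoc Rinv_r ?Rmult_1_l; last nra.
  have := pow_le r n (Rlt_le _ _ r0); rewrite /=.
  move: (r ^ n) => q q0.
  have : 0 <= r * q by nra.
  by nra.
apply: (ex_series_scal_l (K := R_AbsRing)).
exact/(ex_series_incr_1 (fun n => a n * r ^ n)).
Qed.

Lemma gf_to_root o y z : Cmod z = r -> adj o y ->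
  gf (fun n => pn p n y o) z =
  Cmult (Cmult (Cmult z (RtoC (p y o))) (gf (fun n => taboo p o y n y) z)) (gf a z).
Proof.
move=> zr oy; have yo : y == o = false.
  by apply/eqP => E; move: oy; rewrite E; case: tree => _ [/(_ o)/negbTE ->].
rewrite {1}/gf CSeries_incr_1; last exact: nbr_conv.
have Ha : Cabs_summable (gterm a z).
  by apply: Cabs_summable_le (ret_conv o zr) => n; rewrite /gterm diag; lra.
rewrite {1}/gterm /= yo Cmult_0_l Cplus_0_l -Cmult_assoc.
apply: is_series_C_unique.
apply: is_series_ext (is_series_scal_Cconv (taboo_conv o y zr) Ha) => n.
rewrite gterm_conv /gterm (pn_to_root tree stoch oy) Cpow_S RtoC_mult.
rewrite (sum_n_ext (fun k => _ * pn _ _ _ _) (fun k => taboo p o y k y * a (n - k)%coq_nat)).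
  by ring_in C.
by move=> k; rewrite diag.
Qed.

Lemma gf_to_self o y z : Cmod z = r -> adj o y ->
  gf a z = Cmult (gf (fun n => taboo p o y n y) z)
    (Cplus (RtoC 1) (Cmult (Cmult z (RtoC (p y o))) (gf (fun n => pn p n o y) z))).
Proof.
move=> zr oy; have yo : adj y o by rewrite (adj_sym tree).
have Ha : Cabs_summable (gterm a z).
  by apply: Cabs_summable_le (ret_conv o zr) => n; rewrite /gterm diag; lra.
have Ht := taboo_conv o y zr.
have EB := CSeries_incr_1 Ht; rewrite -/(gf _ z) in EB.
rewrite {1}/gf CSeries_incr_1 //.
transitivity (Cplus (gterm (fun n => taboo p o y n y) z 0) (Cplus
  (CSeries (fun n => gterm (fun n => taboo p o y n y) z n.+1))
  (Cmult (Cmult z (RtoC (p y o))) (Cmult (gf (fun n => taboo p o y n y) z)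
     (gf (fun n => pn p n o y) z))))); last by rewrite Cplus_assoc -EB; ring.
congr Cplus; first by rewrite /gterm -(diag 0 y) /=.
apply: is_series_C_unique.
apply: is_series_ext (is_series_plus _ _ _ _
  (CSeries_correct (Cabs_summable_incr_1 Ht))
  (is_series_scal_Cconv Ht (nbr_conv zr yo))) => n.
rewrite gterm_conv /gterm -(diag n.+1 y) (pn_to_self tree stoch oy) Cpow_S.
by rewrite /plus /= RtoC_plus RtoC_mult; ring_in C.
Qed.

(** With [Z] the analogue of [X] for the reversed edge, the two orientations give [X (1 + Z)] and
    [Z (1 + X)] the same value [c2 (z A)^2]. Subtracting [X Z] from both leaves [X = Z], and each
    equation then involves [X] alone. The factor [z] in [z A] and [z B] turns generating functions
    into Green functions. *)
Lemma edge_equations o y z : Cmod z = r -> adj o y ->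
  let A := gf a z in
  let B := gf (fun n => taboo p o y n y) z in
  let X := Cmult (Cmult z (RtoC (p o y))) (gf (fun n => pn p n y o) z) in
  let c2 := RtoC (p o y * p y o) in
  Cmult X (Cplus (RtoC 1) X) = Cmult c2 (Cmult (Cmult z A) (Cmult z A)) /\
  X = Cmult (Cmult c2 (Cmult (Cmult z B) (Cmult z B))) (Cplus (RtoC 1) X).
Proof.
move=> zr oy A B X c2; have yo : adj y o by rewrite (adj_sym tree).
have E1 := gf_to_root zr oy; have E2 := gf_to_self zr oy.
have F1 := gf_to_root zr yo; have F2 := gf_to_self zr yo.
rewrite -/A -/B in E1 E2; rewrite -/A in F1 F2.
set B' := gf (fun n => taboo p y o n o) z in F1 F2.
set Y := gf (fun n => pn p n y o) z in E1 F2 X *.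
set O := gf (fun n => pn p n o y) z in E2 F1 *.
pose Z := Cmult (Cmult z (RtoC (p y o))) O.
have XE : X = Cmult (Cmult c2 (Cmult z z)) (Cmult B A).
  by rewrite /X E1 /c2 RtoC_mult; ring.
have ZE : Z = Cmult (Cmult c2 (Cmult z z)) (Cmult B' A).
  by rewrite /Z F1 /c2 RtoC_mult; ring.
have HX : Cmult X (Cplus (RtoC 1) Z) = Cmult c2 (Cmult (Cmult z A) (Cmult z A)).
  by rewrite XE {3}E2 -/Z; ring.
have HZ : Cmult Z (Cplus (RtoC 1) X) = Cmult c2 (Cmult (Cmult z A) (Cmult z A)).
  by rewrite ZE {3}F2 -/Z -/X; ring.
have XZ : X = Z.
  have -> : X = Cminus (Cmult X (Cplus (RtoC 1) Z)) (Cmult X Z) by ring.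
  by rewrite HX -HZ; ring.
split; first by rewrite -HX -XZ.
by rewrite {1}XE E2 -/Z -XZ; ring.
Qed.

Lemma Re_edge_pos o y z : Cmod z = r -> adj o y ->
  0 < Re (Cplus (RtoC 1) (Cmult (RtoC 2)
    (Cmult (Cmult z (RtoC (p o y))) (gf (fun n => pn p n y o) z)))).
Proof.
move=> zr oy; have zR : Cmod (RtoC r) = r by rewrite Cmod_R Rabs_pos_eq; lra.
have [_] := edge_equations zr oy; have [_] := edge_equations zR oy.
set X := Cmult _ (gf (fun n => pn p n y o) z).
have c0 : 0 < p o y * p y o.
  by apply: Rmult_lt_0_compat; apply: (p_gt0 stoch) => //; rewrite (adj_sym tree).
have t0 n : 0 <= taboo p o y n y by case: (taboo_bounds stoch o y n y).
have rn n : 0 <= r ^ n by apply: pow_le; lra.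
set c2 := p o y * p y o in c0 *.
rewrite !gf_RtoC; set w := Series (fun n => _ * _); set b := Series (fun n => _ * _).
have S1 : ex_series (fun n => taboo p o y n y * r ^ n).
  by apply: ex_series_ext (taboo_conv o y zR) => n; rewrite Cmod_gterm ?zR.
have S2 : ex_series (fun n => pn p n y o * r ^ n).
  apply: ex_series_ext (nbr_conv zR oy) => n; rewrite Cmod_gterm ?zR //.
  by case: (pnb n y o).
have b0 : 0 <= b by apply: Series_ge0 S1 => n; exact: Rmult_le_pos (t0 n) (rn n).
have w0 : 0 <= w.
  by apply: Series_ge0 S2 => n; apply: Rmult_le_pos (rn n); case: (pnb n y o).
rewrite -!RtoC_mult -!RtoC_plus -!RtoC_mult => /RtoC_inj Er Ez.
(* The real equation is [x = v (1 + x)] with [x >= 0]; [v >= 1] would give [x >= 1 + x]. *)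
have small : c2 * (r * b * (r * b)) < 1.
  have x0 : 0 <= r * p o y * w.
    by apply: Rmult_le_pos => //; apply: Rmult_le_pos; [lra | exact: ge0].
  move: Er x0; set x := r * p o y * w; set v := c2 * _ => Er x0; nra.
have Bb : Cmod (gf (fun n => taboo p o y n y) z) <= b.
  by apply: Cmod_CSeries_le => // n; rewrite Cmod_gterm // zr; lra.
(* If [1 + X] were 0, the second edge equation would give [X = 0]. This makes the comparison of
   moduli strict. *)
have X1 : Cplus (RtoC 1) X <> RtoC 0.
  move=> E; rewrite E Cmult_0_r in Ez; move: E; rewrite Ez Cplus_0_r.
  by move=> /RtoC_inj; lra.
have M : Cmod X < Cmod (Cplus (RtoC 1) X).
  have P := (proj1 (Cmod_gt_0 _)) X1.
  rewrite {1}Ez !Cmod_mult Cmod_R Rabs_pos_eq; last lra.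
  rewrite zr; move: (Cmod_ge_0 (gf (fun n => taboo p o y n y) z)) Bb.
  set m := Cmod (gf _ z) => m0 mb.
  have : r * m * (r * m) <= r * b * (r * b).
    by apply: Rmult_le_compat; nra.
  by set u := r * m * _ => ub; have : c2 * u < 1; nra.
(* Squared, [|X| < |1 + X|] says [0 < 1 + 2 Re X]. *)
have := Cmod2_alt X; have := Cmod2_alt (Cplus (RtoC 1) X).
have := Cmod_ge_0 X; case: (X) M => x y' /= M P0 P1 P2; nra.
Qed.

Lemma Csqrt_edge o y z : Cmod z = r -> adj o y ->
  let g := Cmult z (gf a z) in
  Cmult (RtoC (/ 2)) (Cminus (Csqrt (Cplus (RtoC 1)
    (Cmult (RtoC (4 * p o y * p y o)) (Cmult g g)))) (RtoC 1)) =
  Cmult (Cmult z (RtoC (p o y))) (gf (fun n => pn p n y o) z).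
Proof.
move=> zr oy g; have [E _] := edge_equations zr oy.
have := Re_edge_pos zr oy; move: E; set X := Cmult _ (gf _ z) => E pos.
rewrite (Csqrt_unique pos).
  by rewrite (_ : RtoC (/ 2) = Cinv (RtoC 2)) ?RtoC_inv //; field.
have -> : RtoC (4 * p o y * p y o) = Cmult (RtoC 4) (RtoC (p o y * p y o)).
  by rewrite -RtoC_mult Rmult_assoc.
rewrite -Cmult_assoc.
rewrite -E (_ : RtoC 4 = Cmult (RtoC 2) (RtoC 2)); first ring.
by rewrite -RtoC_mult; congr RtoC; lra.
Qed.

(** Walks of positive length are sorted by their first step; after the sums over length and over
    neighbours are exchanged, each neighbour contributes its [X], which [Csqrt_edge] expresses by
    the square root. *)
Lemma gf_Phi o z : Cmod z = r -> gf a z = Phi adj p o (Cmult z (gf a z)).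
Proof.
move=> zr; have Ha : Cabs_summable (gterm a z).
  by apply: Cabs_summable_le (ret_conv o zr) => n; rewrite /gterm diag; lra.
rewrite {1}/gf CSeries_incr_1 //.
pose f n k := Cmult (RtoC (enum_term (fun y => p o y * pn p n y o) k)) (Cpow z n.+1).
have e0 n k : 0 <= enum_term (fun y => p o y * pn p n y o) k.
  apply: enum_term_ge0 => y; apply: Rmult_le_pos; first exact: ge0.
  by case: (pnb n y o).
have fM n k : Cmod (f n k) = r ^ n.+1 * enum_term (fun y => p o y * pn p n y o) k.
  by rewrite Cmod_mult Cmod_R Cmod_Cpow zr Rabs_pos_eq // Rmult_comm.
have fS n : Cabs_summable (f n).
  apply: ex_series_ext (ex_series_scal_l (K := R_AbsRing) (r ^ n.+1) _
    (summable_pn stoch n o o)) => k; by rewrite fM.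
have H : is_series (K := C_AbsRing) (V := C_NormedModule)
    (fun k => CSeries (fun n => f n k)) (CSeries (fun n => CSeries (f n))).
  apply: (CSeries_exchange (M := fun n => a n.+1 * r ^ n.+1)) => // [n|].
    rewrite (Series_ext _ _ (fM n)) Series_scal_l -[Series _]/(pn p n.+1 o o) diag.
    by rewrite Rmult_comm; exact: Rle_refl.
  exact/(ex_series_incr_1 (fun n => a n * r ^ n)).
rewrite /Phi; congr Cplus; first by rewrite /gterm -(diag 0 o) /= eqxx Cmult_1_r.
have -> : CSeries (fun n => gterm a z n.+1) = CSeries (fun n => CSeries (f n)).
  apply: CSeries_ext => n; rewrite /gterm -(diag n.+1 o).
  rewrite -[pn _ _ _ _]/(vsum (fun y => p o y * pn p n y o)) /vsum -CSeries_RtoC Cmult_comm -CSeries_scal.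
    by apply: CSeries_ext => k; rewrite /f Cmult_comm.
  apply: Cabs_summable_le (summable_pn stoch n o o) => k.
  by rewrite Cmod_R Rabs_pos_eq //; exact: Rle_refl.
rewrite -(is_series_C_unique H); apply: CSeries_ext => k.
rewrite /enum_termC /f /enum_term; case: pickle_inv => [y|]; last first.
  rewrite (CSeries_ext (b := fun n => RtoC 0)) => [|n]; last by rewrite Cmult_0_l.
  by rewrite CSeries_RtoC Series_const0.
case: ifP => oy; last first.
  rewrite (CSeries_ext (b := fun n => RtoC 0)) => [|n].
    by rewrite CSeries_RtoC Series_const0.
  by rewrite (p_eq0 stoch (negbT oy)) Rmult_0_l Cmult_0_l.
rewrite (Csqrt_edge zr oy) /gf -CSeries_scal; last exact: nbr_conv.
apply: CSeries_ext => n; rewrite /gterm Cpow_S RtoC_mult; ring.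
Qed.

End Green.

(** * The spectral radius *)

Section Transitive.
Variables (V : countType) (adj : rel V) (p : V -> V -> R) (Gam : (V -> V) -> Prop).
Hypotheses (tree : is_tree adj) (stoch : nn_stochastic adj p).
Hypotheses (aut : aut_subgroup adj Gam) (trans : vertex_transitive Gam).
Hypothesis inv : p_invariant Gam p.

Lemma pn_inv g n x y : Gam g -> pn p n (g x) (g y) = pn p n x y.
Proof.
move=> Gg; have [gbij _] : is_aut adj g by case: aut => H _; exact: H.
elim: n x => [|n IH] x /=; first by rewrite (bij_eq gbij).
rewrite -(vsum_bij (f := fun z => p (g x) z * pn p n z (g y)) (s := g)) //.
- by apply: vsum_ext => z; rewrite inv // IH.
- by move=> z; apply: Rmult_le_pos; [exact: p_ge0 stoch _ _ | case: (pn_bounds stoch n z (g y))].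
apply: summable_le (summable_pn stoch n x y) => z.
rewrite inv // IH Rabs_pos_eq; first lra.
by apply: Rmult_le_pos; [exact: p_ge0 stoch _ _ | case: (pn_bounds stoch n z y)].
Qed.

Lemma pn_diag n x y : pn p n x x = pn p n y y.
Proof. by have [g [Gg <-]] := trans x y; rewrite pn_inv. Qed.

Lemma summable_edge (phi : R -> R -> R) c x :
  (forall y, 0 <= phi (p x y) (p y x) <= c * p x y) ->
  summable (fun y => phi (p x y) (p y x)).
Proof.
move=> H; apply: summable_le (summable_scal c (summable_p stoch x)) => y.
by rewrite Rabs_pos_eq; case: (H y).
Qed.

(** A sum over [y] of a function of the two weights of the pair is the same at every vertex. Hence
    one constant serves as superharmonicity factor everywhere. *)
Lemma vsum_edge (phi : R -> R -> R) c x o :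
  (forall x y, 0 <= phi (p x y) (p y x) <= c * p x y) ->
  vsum (fun y => phi (p x y) (p y x)) = vsum (fun y => phi (p o y) (p y o)).
Proof.
move=> H; have [g [Gg <-]] := trans o x.
have [gbij _] : is_aut adj g by case: aut => K _; exact: K.
rewrite -(vsum_bij (f := fun y => phi (p (g o) y) (p y (g o))) (s := g)) //.
- by apply: vsum_ext => y; rewrite !inv.
- by move=> y; case: (H (g o) y).
apply: summable_le (summable_edge (phi := phi) (H o)) => y.
by rewrite !inv // Rabs_pos_eq; [lra | case: (H o y)].
Qed.

(** * Superharmonic functions as products along geodesics *)

Section Superharmonic.
Variables (o : V) (t : R).
Hypothesis t0 : 0 < t.

Definition edge_root (x y : V) : R := (sqrt (1 + 4 * p x y * p y x * (t * t)) - 1) / 2.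

Lemma edge_root_spec x y :
  edge_root x y * (1 + edge_root x y) = p x y * p y x * (t * t) /\
  0 <= edge_root x y <= (t * t) * p x y.
Proof.
have a0 := p_ge0 stoch x y; have b0 := p_ge0 stoch y x; have b1 := p_le1 stoch y x.
have ab : 0 <= p x y * p y x <= p x y by split; nra.
have c0 : 0 <= p x y * p y x * (t * t) by have : 0 < t * t; nra.
have S := sqrt_sqrt (1 + 4 * p x y * p y x * (t * t)) ltac:(nra).
have S1 : 1 <= sqrt (1 + 4 * p x y * p y x * (t * t)).
  by rewrite -{1}sqrt_1; apply: sqrt_le_1_alt; nra.
rewrite /edge_root; set s := sqrt _ in S S1 *; split; first nra.
have : 0 < t * t by nra.
split; nra.
Qed.

Definition edge_ratio (x y : V) : R := edge_root x y / (p y x * t).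

Lemma edge_rootC x y : edge_root x y = edge_root y x.
Proof. by rewrite /edge_root; congr ((sqrt _ - _) / _); ring. Qed.

Lemma edge_root_gt0 x y : adj x y -> 0 < edge_root x y.
Proof.
move=> xy; have [E [H _]] := edge_root_spec x y.
have a0 := p_gt0 stoch xy; have b0 : 0 < p y x by apply: (p_gt0 stoch); rewrite (adj_sym tree).
have : 0 < p x y * p y x * (t * t) by repeat apply: Rmult_lt_0_compat.
by rewrite -E; nra.
Qed.

Lemma geodesic_ex x : exists s, simple_path adj x o s.
Proof. by case: tree => _ [_ /(_ x o)[s [H _]]]; exists s. Qed.

Definition geodesic x := xchoose (geodesic_ex x).

Lemma geodesicP x : simple_path adj x o (geodesic x).
Proof. exact: xchooseP. Qed.

Lemma geodesic_unique x s : simple_path adj x o s -> geodesic x = s.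
Proof.
case: tree => _ [_ /(_ x o)[s' [_ U]]] H.
by rewrite -(U _ (geodesicP x)) -(U _ H).
Qed.

(** Of two neighbours one is the parent of the other, seen from the root [o]. If [y] is off the
    geodesic of [x], prefixing the edge gives a simple path from [y]; otherwise the part after [y]
    is the geodesic of [y], and the edge to [y] followed by it is simple, hence the geodesic of
    [x]. *)
Lemma geodesic_nbr x y : adj x y ->
  geodesic y = x :: geodesic x \/ geodesic x = y :: geodesic y.
Proof.
move=> xy; have yx : adj y x by rewrite (adj_sym tree).
have nxy : y != x.
  by apply/eqP => E; move: xy; rewrite E; case: tree => _ [/(_ x)/negbTE ->].
have := geodesicP x; rewrite /simple_path => /and3P[px lx ux].
case: (boolP (y \in geodesic x)) => yin; [right | left]; last first.
  apply: geodesic_unique; rewrite /simple_path [path _ _ _]/= yx px [last _ _]/= lx /=.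
  by rewrite inE negb_or nxy yin.
have [s1 [s2 Es]] : exists s1 s2, geodesic x = s1 ++ y :: s2.
  by case/splitPr: yin => s1 s2; exists s1, s2.
rewrite {}Es in px lx ux; move: px lx ux.
rewrite cat_path last_cat /= cat_uniq mem_cat negb_or inE negb_or.
move=> /and3P[_ _ ps2] ls2 /and3P[/and3P[_ xy' xs2] _ /and3P[_ ys2 us2]].
have E : geodesic y = s2 by apply: geodesic_unique; rewrite /simple_path ps2 ls2 /= ys2.
rewrite E; apply: geodesic_unique.
by rewrite /simple_path /= xy ps2 ls2 /= inE negb_or xy' xs2 ys2.
Qed.

Fixpoint path_weight x (s : seq V) : R :=
  if s is y :: s' then edge_ratio x y * path_weight y s' else 1.

Definition superharm x := path_weight x (geodesic x).

Lemma superharm_gt0 x : 0 < superharm x.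
Proof.
have /and3P[ps _ _] := geodesicP x; rewrite /superharm.
move: (geodesic x) ps => s; elim: s x => [|y s IH] x /=; first by move=> _; lra.
move=> /andP[xy /IH H]; apply: Rmult_lt_0_compat => //.
apply: Rdiv_lt_0_compat; first exact: edge_root_gt0.
by apply: Rmult_lt_0_compat => //; apply: (p_gt0 stoch); rewrite (adj_sym tree).
Qed.

(** With [X] the edge root, a child contributes [X f(x) / t] and the parent [(1 + X) f(x) / t], by
    [X (1 + X) = c2 t^2]; the surplus [f(x) / t] occurs once. At the root [head] defaults to [x],
    which is no neighbour, so there the bound on [P f] has slack. *)
Lemma superharm_nbr x y : adj x y -> p x y * superharm y <=
  superharm x / t * edge_root x y +
  (if y == head x (geodesic x) then superharm x / t else 0).
Proof.
move=> xy; have yx : adj y x by rewrite (adj_sym tree).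
have a0 := p_gt0 stoch xy; have b0 := p_gt0 stoch yx.
have fx := superharm_gt0 x; have fy := superharm_gt0 y.
have ft : 0 < superharm x / t by exact: Rdiv_lt_0_compat.
case: (geodesic_nbr xy) => E.
  have -> : superharm y = edge_ratio y x * superharm x by rewrite /superharm E.
  rewrite /edge_ratio (edge_rootC y x).
  have -> : p x y * (edge_root x y / (p x y * t) * superharm x) =
            superharm x / t * edge_root x y by field; lra.
  by case: eqP => _; lra.
rewrite E eqxx.
have -> : superharm x = edge_ratio x y * superharm y by rewrite {1}/superharm E.
have [R1 _] := edge_root_spec x y.
apply: Req_le; rewrite /edge_ratio.
transitivity (edge_root x y * (1 + edge_root x y) * (superharm y / (p y x * (t * t)))).
  by rewrite R1; field; lra.
by field; lra.
Qed.

Lemma pn_le_superharm n x :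
  pn p n x o <= ((1 + vsum (edge_root o)) / t) ^ n * superharm x.
Proof.
have S y : summable (edge_root y).
  apply: (@summable_edge (fun a b => (sqrt (1 + 4 * a * b * (t * t)) - 1) / 2) (t * t)).
  by move=> z; case: (edge_root_spec y z).
have SE x' : vsum (edge_root x') = vsum (edge_root o).
  apply: (@vsum_edge (fun a b => (sqrt (1 + 4 * a * b * (t * t)) - 1) / 2) (t * t)).
  by move=> y z; case: (edge_root_spec y z).
have S0 : 0 <= vsum (edge_root o).
  by apply: vsum_ge0 => // y; case: (edge_root_spec o y) => _ [].
set r := (1 + _) / t; have r0 : 0 <= r by apply: Rdiv_le_0_compat => //; lra.
elim: n x => [|n IH] x.
  rewrite /= Rmult_1_l; case: eqP => [->|_]; last exact: Rlt_le (superharm_gt0 x).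
  by rewrite /superharm (@geodesic_unique o [::]) /=; [lra | rewrite /simple_path /= eqxx].
have rn := pow_le r n r0.
(* [b] majorizes [p x y * superharm y] and sums to exactly [r * superharm x], so the summability of
   the latter products need not be shown beforehand. *)
pose b y := superharm x / t * edge_root x y +
  (if y == head x (geodesic x) then superharm x / t else 0).
have Sd := summable_delta (head x (geodesic x)) (superharm x / t).
have Ss := summable_scal (superharm x / t) (S x).
have Sb : summable b by exact: summable_plus.
have Eb : vsum b = r * superharm x.
  rewrite vsum_plus // vsum_scal vsum_delta SE /r; field; lra.
apply: Rle_trans (_ : r ^ n * vsum b <= _); last by rewrite Eb /=; lra.
rewrite -vsum_scal; apply: vsum_le => [||y].
- exact: (summable_pn stoch).
- exact: summable_scal Sb.
case xy: (adj x y).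
  have := superharm_nbr xy; rewrite -/(b y) => Hb.
  apply: Rle_trans (_ : r ^ n * (p x y * superharm y) <= _); last first.
    exact: Rmult_le_compat_l.
  rewrite -Rmult_assoc [r ^ n * _]Rmult_comm Rmult_assoc.
  by apply: Rmult_le_compat_l; [exact: p_ge0 stoch _ _ | exact: IH].
rewrite (p_eq0 stoch (negbT xy)) Rmult_0_l; apply: Rmult_le_pos => //.
have f0 : 0 < superharm x / t by apply: Rdiv_lt_0_compat => //; exact: superharm_gt0.
have [_ [e0 _]] := edge_root_spec x y.
by rewrite /b; case: eqP => _; nra.
Qed.

Lemma ret_le_pow n : pn p n o o <= ((1 + vsum (edge_root o)) / t) ^ n.
Proof.
have := pn_le_superharm n o.
by rewrite /superharm (@geodesic_unique o [::]) /= ?Rmult_1_r // /simple_path /= eqxx.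
Qed.

End Superharmonic.
End Transitive.

(** * Spectral radius and the root test *)

Section SpectralRadius.
Variables (V : countType) (adj : rel V) (p : V -> V -> R) (o : V).
Hypotheses (stoch : nn_stochastic adj p).

Lemma rootn_le (b r : R) n : 0 <= r -> b <= r ^ n.+1 -> rootn b n.+1 <= r.
Proof.
move=> r0 br; rewrite /rootn; case: Rle_dec => [//|nb]; have b0 := Rnot_le_lt _ _ nb.
have {}r0 : 0 < r.
  case: r0 => // E; move: br; rewrite -E pow_i; [lra | lia].
have nS : INR n.+1 <> 0 by exact: not_0_INR.
rewrite -[X in _ <= X](Rpower_1 r) // -(Rinv_r (INR n.+1)) // -Rpower_mult Rpower_pow //.
apply: Rle_Rpower_l; last lra.
by apply: Rlt_le; apply: Rinv_0_lt_compat; apply: lt_0_INR; lia.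
Qed.

Lemma le_rootn_pow (b r : R) n : rootn b n.+1 <= r -> 0 <= r -> b <= r ^ n.+1.
Proof.
rewrite /rootn; case: Rle_dec => [b0 _ r0|nb br _]; last have b0 := Rnot_le_lt _ _ nb.
  by have := pow_le r n.+1 r0; lra.
have nS : INR n.+1 <> 0 by exact: not_0_INR.
have -> : b = Rpower b (/ INR n.+1) ^ n.+1.
  by rewrite -Rpower_pow ?Rpower_mult ?Rinv_l ?Rpower_1 //; exact: exp_pos.
by apply: pow_incr; split => //; apply: Rlt_le; exact: exp_pos.
Qed.

(** The limsup is an extended real lying between 0 and 1, so [real] in [spec_rad] loses nothing. *)
Lemma spec_rad_LimSup :
  is_LimSup_seq (fun n => rootn (pn p n o o) n) (spec_rad p o) /\ 0 <= spec_rad p o.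
Proof.
set u := fun n => _; have H : is_LimSup_seq u (LimSup_seq u) := proj2_sig (ex_LimSup_seq u).
have H1 : Rbar_le (LimSup_seq u) 1.
  rewrite -(LimSup_seq_const 1); apply: LimSup_le; exists 1%nat => -[|n] ?; first lia.
  by apply: rootn_le; [lra | rewrite pow1; case: (pn_bounds stoch n.+1 o o)].
have H0 : Rbar_le 0 (LimSup_seq u).
  rewrite -(LimSup_seq_const 0); apply: LimSup_le; exists 0%nat => n _.
  rewrite /u /rootn; case: Rle_dec => ? /=; first lra.
  by apply: Rlt_le; exact: exp_pos.
by move: H H1 H0; rewrite /spec_rad -/u; case: (LimSup_seq u).
Qed.

Lemma spec_rad_le r : 0 <= r -> (forall n, pn p n o o <= r ^ n) -> spec_rad p o <= r.
Proof.
move=> r0 H; have [/is_LimSup_seq_unique E _] := spec_rad_LimSup.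
have : Rbar_le (LimSup_seq (fun n => rootn (pn p n o o) n)) r.
  rewrite -(LimSup_seq_const r); apply: LimSup_le; exists 1%nat => -[|n] ?; first lia.
  exact: rootn_le.
by rewrite E.
Qed.

Lemma spec_rad_conv r : spec_rad p o < r -> ex_series (fun n => pn p n o o * (/ r) ^ n).
Proof.
move=> Hr; have [H rho0] := spec_rad_LimSup.
have e0 : 0 < (r - spec_rad p o) / 2 by lra.
have [_ [N HN]] := H (mkposreal _ e0).
apply/(ex_series_incr_n _ N.+1).
(* Root test with the midpoint [q]: beyond [N] the return probabilities are at most [q ^ n], and
   [q / r < 1]. *)
set q := (r + spec_rad p o) / 2.
have q0 : 0 <= q / r by apply: Rdiv_le_0_compat; rewrite /q; lra.
have q1 : q / r < 1 by apply/Rlt_div_l; rewrite /q; lra.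
have r0 : 0 < r by lra.
have q00 : 0 <= q by rewrite /q; lra.
have G := ex_series_scal_l (K := R_AbsRing) ((q / r) ^ N.+1) _
  (ex_series_geom (q / r) ltac:(rewrite Rabs_pos_eq //)).
apply: ex_series_abs_le G => n.
have -> : scal ((q / r) ^ N.+1) ((q / r) ^ n) = (q / r) ^ (N.+1 + n)%coq_nat.
  by rewrite pow_add.
rewrite Rabs_pos_eq; last first.
  apply: Rmult_le_pos; first by case: (pn_bounds stoch (N.+1 + n)%coq_nat o o).
  by apply: pow_le; apply: Rlt_le; exact: Rinv_0_lt_compat.
rewrite Rpow_mult_distr; apply: Rmult_le_compat_r.
  by apply: pow_le; apply: Rlt_le; exact: Rinv_0_lt_compat.
apply: le_rootn_pow => //.
have /= := HN (N.+1 + n)%coq_nat ltac:(lia); rewrite /q => Hk.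
by apply: Rlt_le; apply: Rlt_le_trans Hk _; lra.
Qed.

End SpectralRadius.

(** * Power series expansion of a square root *)

(* Coefficients of the power series [e] with [2 e + e^2 = v] and [e 0 = 0];
   [root_pre v n] is its truncation to degree [n]. *)
Fixpoint root_pre (v : nat -> C) (n : nat) : nat -> C :=
  match n with
  | O => fun=> RtoC 0
  | S m => fun k => if k == m.+1
      then Cmult (RtoC (/ 2)) (Cminus (v m.+1) (Cconv (root_pre v m) (root_pre v m) m.+1))
      else root_pre v m k
  end.
Definition root_coef v n := root_pre v n n.

Lemma root_pre_le v n k : (k <= n)%N -> root_pre v n k = root_coef v k.
Proof.
elim: n k => [|n IH] k; first by rewrite leqn0 => /eqP ->.
rewrite leq_eqVlt => /orP[/eqP -> //|kn]; rewrite -IH //=.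
by case: eqP => // E; rewrite E ltnn in kn.
Qed.

(** Since the constant coefficient is 0, both end terms of the convolution at [n.+1] vanish, and it
    involves only coefficients of degree 1 to [n], where [root_pre] agrees with [root_coef]. *)
Lemma root_coef_S v n : root_coef v n.+1 =
  Cmult (RtoC (/ 2)) (Cminus (v n.+1) (Cconv (root_coef v) (root_coef v) n.+1)).
Proof.
rewrite {1}/root_coef /= eqxx; congr (Cmult _ (Cminus _ _)).
have e0 : root_coef v 0 = RtoC 0 by [].
have p0 : root_pre v n 0 = RtoC 0 by rewrite root_pre_le.
apply: sum_n_ext_loc => k /leP; rewrite leq_eqVlt => /orP[/eqP ->|].
  by rewrite Nat.sub_diag e0 p0 !Cmult_0_r.
case: k => [_|k kn]; first by rewrite e0 p0 !Cmult_0_l.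
rewrite !root_pre_le //; apply/leP; lia.
Qed.

Lemma Cconv_weight (b c : nat -> C) z n :
  Cconv (fun n => Cmult (b n) (Cpow z n)) (fun n => Cmult (c n) (Cpow z n)) n =
  Cmult (Cconv b c n) (Cpow z n).
Proof.
rewrite -[RHS](sum_n_mult_r (K := C_Ring)); apply: sum_n_ext_loc => k kn.
have -> : Cpow z n = Cmult (Cpow z k) (Cpow z (n - k)%coq_nat).
  by rewrite -Cpow_add; congr pow_n; lia.
rewrite /mult /=; ring_in C.
Qed.

Lemma Cmod_sum_n_le (f : nat -> C) N :
  Cmod (@sum_n C_AbelianGroup f N) <= sum_n (fun n => Cmod (f n)) N.
Proof.
elim: N => [|N IH]; first by rewrite !sum_O; lra.
rewrite !sum_Sn; apply: Rle_trans (Cmod_triangle _ _) _.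
by rewrite /plus /=; lra.
Qed.

Lemma sum_n_stable (f : nat -> R) N : (forall n, (N < n)%N -> f n = 0) ->
  is_series f (sum_n f N).
Proof.
move=> H; apply/filterlim_locally => eps; exists N => M /leP NM.
have -> : sum_n f M = sum_n f N; last exact: ball_center.
elim: M NM => [|M IH]; first by rewrite leqn0 => /eqP ->.
rewrite leq_eqVlt => /orP[/eqP -> //|NM].
by rewrite sum_Sn H // IH // /plus /= Rplus_0_r.
Qed.

Lemma sum_n_conv_le (f : nat -> R) N M : (forall n, 0 <= f n) ->
  (forall n, (N < n)%N -> f n = 0) ->
  sum_n (fun n => sum_n (fun k => f k * f (n - k)%coq_nat) n) M <= sum_n f N * sum_n f N.
Proof.
move=> f0 H; have S := sum_n_stable H.
have A : ex_series (fun n => Rabs (f n)).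
  by apply: ex_series_ext (ex_intro _ _ S) => n; rewrite Rabs_pos_eq.
have P := is_series_mult _ _ _ _ S S A A.
rewrite -(is_series_unique _ _ P).
rewrite (Series_ext _ (fun n => sum_n (fun k => f k * f (n - k)%coq_nat) n)); last first.
  by move=> n; rewrite sum_n_Reals.
apply: sum_n_le_Series => [n|].
  by apply: sum_n_ge0 => k; exact: Rmult_le_pos.
by exists (sum_n f N * sum_n f N); apply: is_series_ext P => n; rewrite sum_n_Reals.
Qed.

Lemma sum_n_le_avg (f u w : nat -> R) N :
  (forall n, (n <= N)%N -> f n <= / 2 * u n + / 2 * w n) ->
  sum_n f N <= / 2 * sum_n u N + / 2 * sum_n w N.
Proof.
elim: N => [|N IH] H; first by rewrite !sum_O; exact: H.
have := H N.+1 (leqnn _); have := IH (fun n nN => H n (leqW nN)).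
rewrite !sum_Sn /plus /=; lra.
Qed.

Definition quad (b g : C) (n : nat) : C :=
  match n with 1%nat => b | 2%nat => g | _ => RtoC 0 end.

Section QuadraticRoot.
Variables (b g : C) (r : R).
Hypotheses (r0 : 0 <= r) (small : Cmod b * r + Cmod g * (r * r) <= 1).
Let e := root_coef (quad b g).

(* The partial sums [T] of the majorant satisfy [T' <= a + T^2/2] with
   [a = small/2], which keeps them below [2 a] because [2 a <= 1]. *)
Lemma root_coef_majorant N :
  sum_n (fun n => Cmod (e n) * r ^ n) N <= Cmod b * r + Cmod g * (r * r).
Proof.
set a := Cmod b * r + _; have b0 := Cmod_ge_0 b; have g0 := Cmod_ge_0 g.
have a0 : 0 <= a by rewrite /a; nra.
have a1 : a <= 1 by exact: small.
have rn n : 0 <= r ^ n by apply: pow_le.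
pose f n := Cmod (e n) * r ^ n.
have f0 n : 0 <= f n by apply: Rmult_le_pos => //; exact: Cmod_ge_0.
have f00 : f 0%nat = 0 by rewrite /f /= Cmod_0 Rmult_0_l.
elim: N => [|N IH]; first by rewrite sum_O -/(f 0%nat) f00.
(* The truncated sequence has a finite sum already bounded by induction; its self-convolution up to
   [N.+1] still dominates that of [e], whose end terms vanish. *)
pose fN n := if (n <= N)%N then f n else 0.
have fN0 n : 0 <= fN n by rewrite /fN; case: ifP => // _; lra.
have E : sum_n fN N = sum_n f N.
  by apply: sum_n_ext_loc => n /leP nN; rewrite /fN nN.
have fN00 : fN 0%nat = 0 by rewrite /fN /= f00.
have HfN n : (N < n)%N -> fN n = 0 by rewrite ltnNge /fN => /negbTE ->.
have V M : sum_n (fun n => Cmod (quad b g n) * r ^ n) M <= a.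
  have Sm : is_series (fun n => Cmod (quad b g n) * r ^ n) a.
    have -> : a = sum_n (fun n => Cmod (quad b g n) * r ^ n) 2.
      by rewrite !sum_Sn sum_O /plus /= Cmod_0 /a; ring.
    apply: sum_n_stable => -[|[|[|n]]] //= _; rewrite Cmod_0; lra.
  rewrite -(is_series_unique _ _ Sm); apply: sum_n_le_Series; last by exists a.
  by move=> n; apply: Rmult_le_pos => //; exact: Cmod_ge_0.
have step n : (n <= N.+1)%N -> f n <= / 2 * (Cmod (quad b g n) * r ^ n) +
    / 2 * sum_n (fun k => fN k * fN (n - k)%coq_nat) n.
  case: n => [|n] nN; first by rewrite f00 sum_O /= Cmod_0; have := fN0 0%nat; nra.
  have C : Cmod (Cconv e e n.+1) * r ^ n.+1 <=
           sum_n (fun k => fN k * fN (n.+1 - k)%coq_nat) n.+1.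
    apply: Rle_trans (_ : sum_n (fun k => f k * f (n.+1 - k)%coq_nat) n.+1 <= _).
      apply: Rle_trans (Rmult_le_compat_r _ _ _ (rn n.+1) (Cmod_sum_n_le _ _)) _.
      rewrite -[X in X <= _](sum_n_mult_r (K := R_Ring)); apply: Req_le.
      apply: sum_n_ext_loc => k kn; rewrite /f.
      transitivity ((Cmod (e k) * Cmod (e (n.+1 - k)%coq_nat)) * r ^ n.+1).
        by rewrite -Cmod_mult.
      have -> : r ^ n.+1 = r ^ k * r ^ (n.+1 - k)%coq_nat.
        by rewrite -pow_add; congr pow; lia.
      by ring_in R.
    apply: Req_le; apply: sum_n_ext_loc => k /leP; rewrite leq_eqVlt => /orP[/eqP ->|].
      by rewrite Nat.sub_diag f00 fN00 !Rmult_0_r.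
    case: k => [_|k kn]; first by rewrite f00 fN00 !Rmult_0_l.
    by rewrite /fN !ifT //; [apply/leP; move/leP: nN; lia | exact: leq_trans kn nN].
  rewrite {1}/f /e root_coef_S -/e Cmod_mult Cmod_R (Rabs_pos_eq (/ 2)); last lra.
  have := Cmod_triangle (quad b g n.+1) (Copp (Cconv e e n.+1)).
  rewrite Cmod_opp => T.
  have := Rmult_le_compat_r _ _ _ (rn n.+1) T; rewrite -/(Cminus _ _); lra.
have H := sum_n_conv_le N.+1 fN0 HfN; rewrite E in H.
have V' := V N.+1.
have := sum_n_le_avg step.
have s0 : 0 <= sum_n f N by exact: sum_n_ge0.
have {}IH : sum_n f N <= a by [].
have s2 : sum_n f N * sum_n f N <= a * 1 by apply: Rmult_le_compat => //; lra.
rewrite -/f; lra.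
Qed.

Lemma root_coef_summable : ex_series (fun n => Cmod (e n) * r ^ n) /\
  Series (fun n => Cmod (e n) * r ^ n) <= Cmod b * r + Cmod g * (r * r).
Proof.
have f0 n : 0 <= Cmod (e n) * r ^ n.
  by apply: Rmult_le_pos; [exact: Cmod_ge_0 | exact: pow_le].
have [l Hl] : ex_finite_lim_seq (sum_n (fun n => Cmod (e n) * r ^ n)).
  apply: (ex_finite_lim_seq_incr _ _ _ root_coef_majorant) => n.
  by rewrite sum_Sn /plus /=; have := f0 n.+1; rewrite /=; lra.
have S : is_series (fun n => Cmod (e n) * r ^ n) l by [].
split; first by exists l.
rewrite (is_series_unique _ _ S).
exact: (is_lim_seq_le _ _ _ _ root_coef_majorant Hl (is_lim_seq_const _)).
Qed.

Lemma root_coef_sum (h : C) : Cmod h <= r ->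
  let E := CSeries (fun n => Cmult (e n) (Cpow h n)) in
  Cabs_summable (fun n => Cmult (e n) (Cpow h n)) /\
  Cmod E <= Cmod b * r + Cmod g * (r * r) /\
  Cmult (Cplus (RtoC 1) E) (Cplus (RtoC 1) E) =
    Cplus (RtoC 1) (Cplus (Cmult b h) (Cmult g (Cmult h h))).
Proof.
move=> hr E; have [S1 S2] := root_coef_summable.
have B n : Cmod (Cmult (e n) (Cpow h n)) <= Cmod (e n) * r ^ n.
  rewrite Cmod_mult Cmod_Cpow; apply: Rmult_le_compat_l; first exact: Cmod_ge_0.
  by apply: pow_incr; split=> //; exact: Cmod_ge_0.
have A := Cabs_summable_le B S1.
split=> //; split; first exact: Rle_trans (Cmod_CSeries_le B S1) S2.
have P := is_series_Cconv A A.
have Q : is_series (K := C_AbsRing) (V := C_NormedModule)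
    (fun n => Cmult (quad b g n) (Cpow h n)) (Cplus (Cmult b h) (Cmult g (Cmult h h))).
  apply/is_series_C.
  have F (k : C -> R) : k (RtoC 0) = 0 -> (forall x y, k (Cplus x y) = k x + k y) ->
      is_series (fun n => k (Cmult (quad b g n) (Cpow h n)))
        (k (Cplus (Cmult b h) (Cmult g (Cmult h h)))).
    move=> k0 kD.
    have -> : k (Cplus (Cmult b h) (Cmult g (Cmult h h))) =
              sum_n (fun n => k (Cmult (quad b g n) (Cpow h n))) 2.
      rewrite !sum_Sn sum_O /plus /= Cmult_0_l k0 kD Rplus_0_l.
      by congr (k _ + k _); rewrite /mult /one /=; ring_in C.
    by apply: sum_n_stable => -[|[|[|n]]] //= _; rewrite Cmult_0_l.
  by split; apply: F.
have R : is_series (K := C_AbsRing) (V := C_NormedModule)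
    (fun n => Cmult (quad b g n) (Cpow h n)) (Cplus (Cmult (RtoC 2) E) (Cmult E E)).
  have H2 := is_series_scal_l (K := C_AbsRing) (V := C_NormedModule) (RtoC 2) _ _
    (CSeries_correct A).
  apply: is_series_ext (is_series_plus _ _ _ _ H2 P) => n.
  rewrite Cconv_weight /plus /scal /= /mult /=.
  have -> : quad b g n = Cplus (Cmult (RtoC 2) (e n)) (Cconv e e n).
    case: n => [|n]; last first.
      rewrite /e root_coef_S -/e RtoC_inv; last lra.
      by field.
    rewrite /Cconv sum_O /e /root_coef /=; ring.
  by ring_in C.
have := is_series_C_unique R; rewrite (is_series_C_unique Q) => ->; ring.
Qed.

End QuadraticRoot.

(** * Analyticity of sums of square roots *)

Definition quad_at (x : R) (z : C) : C := Cplus (RtoC 1) (Cmult (RtoC x) (Cmult z z)).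

(* Taylor coefficients at [z0] of [z |-> (sqrt (1 + x z^2) - 1) / 2]. *)
Definition sqrt_coef (x : R) (z0 : C) (n : nat) : C :=
  let q := quad_at x z0 in
  Cplus (if n == 0%nat then Cmult (RtoC (/ 2)) (Cminus (Csqrt q) (RtoC 1)) else RtoC 0)
    (Cmult (Cmult (RtoC (/ 2)) (Csqrt q))
      (root_coef (quad (Cdiv (Cmult (RtoC (2 * x)) z0) q) (Cdiv (RtoC x) q)) n)).

Lemma sqrt_coef_1 x z0 : quad_at x z0 <> RtoC 0 ->
  sqrt_coef x z0 1 = Cdiv (Cmult (RtoC (x / 2)) z0) (Csqrt (quad_at x z0)).
Proof.
move=> q0; rewrite /sqrt_coef Cplus_0_l root_coef_S [quad _ _ 1]/=.
rewrite /Cconv sum_Sn sum_O /root_coef /= /plus /=.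
set s := Csqrt _; have E : Cmult s s = quad_at x z0 by exact: Csqrt_sqr.
have s0 : s <> RtoC 0 by move=> Es; apply: q0; rewrite -E Es Cmult_0_l.
rewrite -E /Rdiv !RtoC_mult !RtoC_inv; try lra.
by field.
Qed.

Section SqrtExpansion.
Variables (z0 : C) (K delta : R).
Hypotheses (K0 : 0 <= K) (delta0 : 0 < delta).
Hypothesis away : forall x, 0 <= x <= K ->
  delta <= Cmod (quad_at x z0) + Re (quad_at x z0).

Lemma quad_at_neq0 x : 0 <= x <= K -> quad_at x z0 <> RtoC 0.
Proof. by move=> /away + E; rewrite E Cmod_0 /=; lra. Qed.

(** The point is that [r] and [c] do not depend on [x] and that the bound is linear in [x]: it can
    then be summed over all weights. *)
Lemma sqrt_expansion : exists r c, 0 < r /\ 0 <= c /\ forall x, 0 <= x <= K ->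
  (ex_series (fun n => Cmod (sqrt_coef x z0 n) * r ^ n) /\
   Series (fun n => Cmod (sqrt_coef x z0 n) * r ^ n) <= c * x) /\
  forall h, Cmod h <= r ->
    CSeries (fun n => Cmult (sqrt_coef x z0 n) (Cpow h n)) =
    Cmult (RtoC (/ 2)) (Cminus (Csqrt (quad_at x (Cplus z0 h))) (RtoC 1)).
Proof.
set Z := Cmod z0; have Z0 : 0 <= Z := Cmod_ge_0 z0.
(* [(Re (Csqrt q))^2 = (|q| + Re q) / 2], so [m] bounds the real part of the root at [z0] from
   below, while [S] bounds its modulus from above. The relative perturbation [E] is kept below
   [eta], and [S * eta < m] keeps the perturbed root in the right half-plane. *)
pose m := sqrt (delta / 2); have m0 : 0 < m by apply: sqrt_lt_R0; lra.
pose S := 2 + K * (Z * Z); have S0 : 0 < S by rewrite /S; nra.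
pose eta := Rmin 1 (m / (2 * S)).
have eta0 : 0 < eta by apply: Rmin_pos; [lra | apply: Rdiv_lt_0_compat; lra].
have eta1 : eta <= 1 := Rmin_l _ _.
have etaS : S * eta < m.
  have : eta <= m / (2 * S) := Rmin_r _ _.
  move=> /(Rmult_le_compat_l S _ _ (Rlt_le _ _ S0)).
  have -> : S * (m / (2 * S)) = m / 2 by field; lra.
  by lra.
(* [|q| >= delta / 2] and [r <= 1] give [|b| + |g| r <= c1 x]; the choice of [r] then makes the
   majorant at most [eta]. *)
pose c1 := (2 * Z + 1) / (delta / 2).
have c10 : 0 < c1 by apply: Rdiv_lt_0_compat; lra.
pose r := Rmin 1 (eta / (K * c1 + 1)).
have Kc : 0 < K * c1 + 1 by nra.
have r0 : 0 < r by apply: Rmin_pos; [lra | apply: Rdiv_lt_0_compat; lra].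
have r1 : r <= 1 := Rmin_l _ _.
have rK : (K * c1 + 1) * r <= eta.
  have : r <= eta / (K * c1 + 1) := Rmin_r _ _.
  move=> /(Rmult_le_compat_l _ _ _ (Rlt_le _ _ Kc)).
  by have -> : (K * c1 + 1) * (eta / (K * c1 + 1)) = eta by field; lra.
exists r, (/ 2 * (Z * Z) + / 2 * S * c1); split=> //; split; first by nra.
move=> x xK; set q := quad_at x z0; set s := Csqrt q.
(* The radicand at [z0 + h] is [q (1 + b h + g h^2)]. *)
set b := Cdiv (Cmult (RtoC (2 * x)) z0) q; set g := Cdiv (RtoC x) q.
have dq := away xK; rewrite -/q in dq.
have q0 : q <> RtoC 0 := quad_at_neq0 xK.
have Mq : delta / 2 <= Cmod q by have := re_le_Cmod q; split_Rabs; lra.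
have Res : m <= Re s by rewrite -[Re s]/(sqrt ((Cmod q + Re q) / 2)); apply: sqrt_le_1_alt; lra.
have Es : Cmult s s = q := Csqrt_sqr q.
have s0 : s <> RtoC 0 by move=> E; apply: q0; rewrite -Es E Cmult_0_l.
have sS : Cmod s <= S.
  have : Cmod q <= 1 + K * (Z * Z).
    apply: Rle_trans (Cmod_triangle _ _) _; rewrite Cmod_1 !Cmod_mult Cmod_R -/Z.
    by rewrite Rabs_pos_eq; nra.
  by rewrite -Es Cmod_mult /S; have := Cmod_ge_0 s; nra.
have a2 : Cmod b * r + Cmod g * (r * r) <= x * c1 * r.
  rewrite /b /g !Cmod_div // Cmod_mult !Cmod_R !Rabs_pos_eq; [|lra|lra].
  rewrite -/Z /c1.
  have -> : 2 * x * Z / Cmod q * r + x / Cmod q * (r * r) =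
            (x * r) * (2 * Z + r) * / Cmod q by field; lra.
  have -> : x * ((2 * Z + 1) / (delta / 2)) * r =
            (x * r) * (2 * Z + 1) * / (delta / 2) by field; lra.
  have xr : 0 <= x * r by nra.
  apply: Rmult_le_compat.
  - by apply: Rmult_le_pos => //; lra.
  - by apply: Rlt_le; apply: Rinv_0_lt_compat; lra.
  - by apply: Rmult_le_compat_l => //; lra.
  - by apply: Rinv_le_contravar; lra.
have aeta : Cmod b * r + Cmod g * (r * r) <= eta.
  apply: Rle_trans a2 _; apply: Rle_trans rK; apply: Rmult_le_compat_r; first lra.
  by have : x * c1 <= K * c1; [apply: Rmult_le_compat_r; lra | lra].
have small : Cmod b * r + Cmod g * (r * r) <= 1 by lra.
have [S1 S2] := root_coef_summable (Rlt_le _ _ r0) small.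
(* From [(s - 1)(s + 1) = x z0^2] and [|s + 1| >= 1]: the constant term, too, is linear in [x]. *)
have s1 : Cmod (Cminus s (RtoC 1)) <= x * (Z * Z).
  have E : Cmult (Cminus s (RtoC 1)) (Cplus s (RtoC 1)) = Cmult (RtoC x) (Cmult z0 z0).
    have -> : Cmult (Cminus s (RtoC 1)) (Cplus s (RtoC 1)) = Cminus (Cmult s s) (RtoC 1) by ring.
    by rewrite Es /q /quad_at; ring.
  have := f_equal Cmod E; rewrite !Cmod_mult Cmod_R Rabs_pos_eq -/Z; last lra.
  have : 1 <= Cmod (Cplus s (RtoC 1)).
    by have := re_le_Cmod (Cplus s (RtoC 1)); rewrite /=; split_Rabs; move: Res; rewrite /=; lra.
  have := Cmod_ge_0 (Cminus s (RtoC 1)); nra.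
have hs : Cmod (Cmult (RtoC (/ 2)) s) = / 2 * Cmod s.
  by rewrite Cmod_mult Cmod_R Rabs_pos_eq; lra.
pose d n := (if n == 0%nat then Cmult (RtoC (/ 2)) (Cminus s (RtoC 1)) else RtoC 0).
have dn n : Cmod (d n) = if n == 0%nat then Cmod (d 0%nat) else 0.
  by rewrite /d; case: eqP => // _; exact: Cmod_0.
have Dser : is_series (fun n => Cmod (d n)) (Cmod (d 0%nat)).
  by apply: is_series_ext (is_series_delta 0 (Cmod (d 0%nat))) => n; rewrite dn.
split.
  have T := is_series_plus _ _ _ _ Dser
    (is_series_scal_l (K := R_AbsRing) (/ 2 * Cmod s) _ _ (Series_correct _ S1)).
  have B n : Cmod (sqrt_coef x z0 n) * r ^ n <=
      Cmod (d n) + / 2 * Cmod s * (Cmod (root_coef (quad b g) n) * r ^ n).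
    have rn : 0 <= r ^ n by apply: pow_le; lra.
    have := Rmult_le_compat_r _ _ _ rn (Cmod_triangle (d n)
      (Cmult (Cmult (RtoC (/ 2)) s) (root_coef (quad b g) n))).
    rewrite -[Cplus _ _]/(sqrt_coef x z0 n) Cmod_mult hs.
    have : Cmod (d n) * r ^ n = Cmod (d n).
      by rewrite dn; case: eqP => [->|_] /=; lra.
    by lra.
  have P n : 0 <= Cmod (sqrt_coef x z0 n) * r ^ n.
    by apply: Rmult_le_pos; [exact: Cmod_ge_0 | apply: pow_le; lra].
  split.
    apply: ex_series_abs_le (ex_intro _ _ T) => n; rewrite Rabs_pos_eq //; exact: B.
  apply: Rle_trans (Series_le _ _ (fun n => conj (P n) (B n)) (ex_intro _ _ T)) _.
  rewrite (is_series_unique _ _ T) /plus /scal /= /mult /=.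
  have -> : Cmod (d 0%nat) = / 2 * Cmod (Cminus s (RtoC 1)).
    by rewrite /d /= Cmod_mult Cmod_R Rabs_pos_eq; lra.
  have := Rmult_le_compat _ _ _ _ (Cmod_ge_0 s) _ sS (Rle_trans _ _ _ S2 a2).
  have := Cmod_ge_0 s; set T' := Series _ => ? H.
  have T0 : 0 <= T'.
    apply: Series_ge0 S1 => n; apply: Rmult_le_pos; first exact: Cmod_ge_0.
    by apply: pow_le; lra.
  have {}H := H T0.
  have : S * (x * c1 * r) <= S * (x * c1).
    by apply: Rmult_le_compat_l; [lra | have : 0 <= x * c1; nra].
  rewrite -/q -/s; lra.
move=> h hr.
have [A [Eb Esq]] := root_coef_sum (Rlt_le _ _ r0) small hr.
set E := CSeries _ in Eb Esq.
have Dh : CSeries d = d 0%nat by exact: is_series_C_unique (is_series_deltaC _ _).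
have -> : CSeries (fun n => Cmult (sqrt_coef x z0 n) (Cpow h n)) =
    Cplus (d 0%nat) (Cmult (Cmult (RtoC (/ 2)) s) E).
  rewrite -Dh -CSeries_scal // -CSeries_plus; last exact: Cabs_summable_scal.
    apply: CSeries_ext => n; rewrite /sqrt_coef -/q -/s -/b -/g /d.
    case: eqP => [->|_]; last ring.
    have -> : Cpow h 0 = RtoC 1 by [].
    by ring.
  by exists (Cmod (d 0%nat)).
(* [s (1 + E)] has the right square and real part at least [m - |s E| > 0], so it is the principal
   root. *)
have -> : Csqrt (quad_at x (Cplus z0 h)) = Cmult s (Cplus (RtoC 1) E).
  apply: Csqrt_unique.
    have -> : Cmult s (Cplus (RtoC 1) E) = Cplus s (Cmult s E) by ring.
    have : Cmod (Cmult s E) < m.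
      rewrite Cmod_mult; apply: Rle_lt_trans etaS.
      by apply: Rmult_le_compat => //; [exact: Cmod_ge_0 | exact: Cmod_ge_0 | lra].
    have := re_le_Cmod (Cmult s E); set sE := Cmult s E.
    have -> : Re (Cplus s sE) = Re s + Re sE by [].
    by split_Rabs; lra.
  have -> : Cmult (Cmult s (Cplus (RtoC 1) E)) (Cmult s (Cplus (RtoC 1) E)) =
    Cmult (Cmult s s) (Cmult (Cplus (RtoC 1) E) (Cplus (RtoC 1) E)) by ring.
  rewrite Es Esq /b /g /Cdiv.
  have -> : Cmult q (Cplus (RtoC 1) (Cplus (Cmult (Cmult (Cmult (RtoC (2 * x)) z0) (Cinv q)) h)
     (Cmult (Cmult (RtoC x) (Cinv q)) (Cmult h h)))) =
     Cplus q (Cplus (Cmult (Cmult (RtoC (2 * x)) z0) h) (Cmult (RtoC x) (Cmult h h))) by field.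
  by rewrite /q /quad_at RtoC_mult; ring.
rewrite /d /=; ring.
Qed.

End SqrtExpansion.

Definition sqrt_sum (w : nat -> R) (z : C) : C :=
  Cplus (RtoC 1) (CSeries (fun i =>
    Cmult (RtoC (/ 2)) (Cminus (Csqrt (quad_at (w i) z)) (RtoC 1)))).

(** The coefficient bound [M] is carried along because differentiability at [z0] is derived from it
    by a quadratic remainder estimate. *)
Definition has_pseries (F : C -> C) (z0 : C) (r M : R) (a : nat -> C) : Prop :=
  [/\ 0 < r, forall n, Cmod (a n) * r ^ n <= M &
      forall z, Cmod (Cminus z z0) < r ->
        is_pseries (K := C_AbsRing) (V := C_NormedModule) a (Cminus z z0) (F z)].

Lemma has_pseries_derive F z0 r M a : has_pseries F z0 r M a ->
  is_derive (K := C_AbsRing) (V := C_NormedModule) F z0 (a 1%nat).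
Proof.
move=> [r0 aM HF].
have M0 : 0 <= M by have := aM 0%nat; have := Cmod_ge_0 (a 0%nat); rewrite /=; lra.
have geom : is_series (fun n => (1 / 2) ^ n) 2.
  have E : / (1 - 1 / 2) = 2 by field.
  by rewrite -[X in is_series _ X]E; apply: is_series_geom; rewrite Rabs_pos_eq; lra.
(* For [|h| <= r / 2] the terms beyond the linear one are dominated by [M (|h| / r)^2] times a
   geometric series of sum 2. *)
have exp2 z : Cmod (Cminus z z0) <= r / 2 -> exists R2,
    F z = Cplus (Cplus (a 0%nat) (Cmult (Cminus z z0) (a 1%nat))) R2 /\
    Cmod R2 <= 2 * M / (r * r) * (Cmod (Cminus z z0) * Cmod (Cminus z z0)).
  set h := Cminus z z0 => hr; have h0 := Cmod_ge_0 h.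
  have B n : Cmod (Cmult (Cpow h n) (a n)) <= M * (Cmod h / r) ^ n.
    rewrite Cmod_mult Cmod_Cpow /Rdiv Rpow_mult_distr.
    have rn : 0 < r ^ n by apply: pow_lt.
    have hn : 0 <= Cmod h ^ n by apply: pow_le.
    have -> : Cmod h ^ n * Cmod (a n) = (Cmod (a n) * r ^ n) * (Cmod h ^ n * (/ r) ^ n).
      rewrite pow_inv; field; lra.
    by apply: Rmult_le_compat_r => //; apply: Rmult_le_pos => //; rewrite pow_inv;
      apply: Rlt_le; apply: Rinv_0_lt_compat.
  have q : 0 <= Cmod h / r <= 1 / 2.
    split; first by apply: Rdiv_le_0_compat.
    by apply/Rle_div_l => //; lra.
  have A : Cabs_summable (fun n => Cmult (Cpow h n) (a n)).
    apply: (Cabs_summable_le (b := fun n => M * (1 / 2) ^ n)).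
      move=> n; apply: Rle_trans (B n) _; apply: Rmult_le_compat_l => //.
      exact: pow_incr.
    exact: (ex_series_scal_l (K := R_AbsRing)) (ex_intro _ _ geom).
  exists (CSeries (fun n => Cmult (Cpow h n.+2) (a n.+2))); split.
    have := is_series_C_unique (HF z _); rewrite -/h => <-; last first.
      by apply: Rle_lt_trans hr _; lra.
    rewrite (CSeries_incr_1 A) (CSeries_incr_1 (Cabs_summable_incr_1 A)).
    have -> : Cpow h 0 = RtoC 1 by [].
    have -> : Cpow h 1 = h by rewrite Cpow_S; exact: Cmult_1_r.
    by ring.
  have G := is_series_scal_l (K := R_AbsRing) (M * (Cmod h / r) ^ 2) _ _ geom.
  have -> : 2 * M / (r * r) * (Cmod h * Cmod h) = M * (Cmod h / r) ^ 2 * 2 by field; lra.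
  rewrite -[X in _ <= X](is_series_unique _ _ G).
  apply: Cmod_CSeries_le (ex_intro _ _ G) => n; apply: Rle_trans (B n.+2) _.
  rewrite -[n.+2]/(2 + n)%coq_nat pow_add -Rmult_assoc; apply: Rmult_le_compat_l.
    by apply: Rmult_le_pos => //; apply: pow_le; lra.
  exact: pow_incr.
have Fz0 : F z0 = a 0%nat.
  have z00 : Cminus z0 z0 = RtoC 0 by rewrite /Cminus Cplus_opp_r.
  have [|R2 []] := exp2 z0; rewrite z00 Cmod_0; first lra.
  rewrite !Rmult_0_r => -> H; have -> : R2 = RtoC 0.
    by apply: Cmod_eq_0; have := Cmod_ge_0 R2; lra.
  by ring.
split; first exact: is_linear_scal_l.
move=> x /is_filter_lim_locally_unique <- eps.
set k := 2 * M / (r * r); have k0 : 0 <= k by apply: Rdiv_le_0_compat; nra.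
(* The [+ 1] covers the case [k = 0]. *)
have d0 : 0 < Rmin (r / 2) (eps / (k + 1)).
  by apply: Rmin_pos; [lra | apply: Rdiv_lt_0_compat; [exact: cond_pos | lra]].
exists (mkposreal _ d0) => z Hz.
have {}Hz : Cmod (Cminus z z0) < Rmin (r / 2) (eps / (k + 1)) by exact: Hz.
have Hz1 := Rlt_le_trans _ _ _ Hz (Rmin_l _ _).
have Hz2 := Rlt_le_trans _ _ _ Hz (Rmin_r _ _).
have [R2 [E B]] := exp2 z (Rlt_le _ _ Hz1).
change (Cmod (Cminus (Cminus (F z) (F z0)) (Cmult (Cminus z z0) (a 1%nat))) <=
  eps * Cmod (Cminus z z0)).
have -> : Cminus (Cminus (F z) (F z0)) (Cmult (Cminus z z0) (a 1%nat)) = R2.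
  by rewrite E Fz0; ring.
apply: Rle_trans B _; rewrite -Rmult_assoc; apply: Rmult_le_compat_r; first exact: Cmod_ge_0.
have := Cmod_ge_0 (Cminus z z0); move: Hz2.
move=> /(Rmult_lt_compat_r (k + 1) _ _ ltac:(lra)).
have -> : eps / (k + 1) * (k + 1) = eps by field; lra.
rewrite -/k; nra.
Qed.

Section SqrtSum.
Variables (w : nat -> R) (K : R).
Hypotheses (wK : forall i, 0 <= w i <= K) (wS : ex_series w).

(** The linear coefficient is recorded because at a positive real [z0] it becomes the derivative of
    Phi. *)
Lemma sqrt_sum_pseries z0 delta : 0 < delta ->
  (forall x, 0 <= x <= K -> delta <= Cmod (quad_at x z0) + Re (quad_at x z0)) ->
  exists r M a, has_pseries (sqrt_sum w) z0 r M a /\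
    a 1%nat = CSeries (fun i => Cdiv (Cmult (RtoC (w i / 2)) z0) (Csqrt (quad_at (w i) z0))).
Proof.
move=> delta0 away; have K0 : 0 <= K by have := wK 0%nat; lra.
have [r [c [r0 [c0 H]]]] := sqrt_expansion K0 delta0 away.
pose f i n := sqrt_coef (w i) z0 n.
have rn n : 0 < r ^ n by apply: pow_lt.
have fS i : ex_series (fun n => Cmod (f i n) * r ^ n) by have [[]] := H _ (wK i).
have fB i : Series (fun n => Cmod (f i n) * r ^ n) <= c * w i by have [[]] := H _ (wK i).
have fE i h := proj2 (H _ (wK i)) h.
have cw : ex_series (fun i => c * w i) by exact: (ex_series_scal_l (K := R_AbsRing)).
have fM i n : Cmod (f i n) * r ^ n <= c * w i.
  apply: Rle_trans (fB i).
  apply: (term_le_Series (a := fun n => Cmod (f i n) * r ^ n)) (fS i) => m.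
  by apply: Rmult_le_pos; [exact: Cmod_ge_0 | exact: Rlt_le].
have fM' i n : Cmod (f i n) <= / r ^ n * (c * w i).
  apply: (Rmult_le_reg_r (r ^ n)) => //; apply: Rle_trans (fM i n) _.
  by apply: Req_le; field; have := rn n; lra.
have cwn n : ex_series (fun i => / r ^ n * (c * w i)).
  exact: (ex_series_scal_l (K := R_AbsRing)).
have fA n : Cabs_summable (fun i => f i n) by apply: Cabs_summable_le (cwn n) => i.
pose d n := if n == 0%nat then RtoC 1 else RtoC 0.
pose A n := CSeries (fun i => f i n).
exists r, (1 + Series (fun i => c * w i)), (fun n => Cplus (d n) (A n)); split; last first.
  rewrite Cplus_0_l; apply: CSeries_ext => i; apply: sqrt_coef_1.
  exact: (quad_at_neq0 delta0 away (wK i)).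
split=> // [n|z zr].
  have An : Cmod (A n) * r ^ n <= Series (fun i => c * w i).
    have := Rmult_le_compat_r _ _ _ (Rlt_le _ _ (rn n)) (Cmod_CSeries_le (fM' ^~ n) (cwn n)).
    rewrite Series_scal_l; set T := Series _.
    have -> : / r ^ n * T * r ^ n = T by field; have := rn n; lra.
    by [].
  have dn : Cmod (d n) * r ^ n <= 1.
    by rewrite /d; case: eqP => [->|_]; rewrite ?Cmod_1 ?Cmod_0 /=; lra.
  have := Rmult_le_compat_r _ _ _ (Rlt_le _ _ (rn n)) (Cmod_triangle (d n) (A n)); lra.
set h := Cminus z z0; have hr : Cmod h <= r by apply: Rlt_le.
have zE : z = Cplus z0 h by rewrite /h; ring.
have B i n : Cmod (Cmult (f i n) (Cpow h n)) <= Cmod (f i n) * r ^ n.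
  rewrite Cmod_mult Cmod_Cpow; apply: Rmult_le_compat_l; first exact: Cmod_ge_0.
  by apply: pow_incr; split=> //; exact: Cmod_ge_0.
have X : is_series (K := C_AbsRing) (V := C_NormedModule)
    (fun n => CSeries (fun i => Cmult (f i n) (Cpow h n)))
    (CSeries (fun i => CSeries (fun n => Cmult (f i n) (Cpow h n)))).
  apply: (CSeries_exchange (M := fun i => c * w i)) => // i.
    exact: Cabs_summable_le (B i) (fS i).
  apply: Rle_trans (fB i); apply: Series_le (fS i) => n.
  by split; [exact: Cmod_ge_0 | exact: B].
have Y := is_series_plus _ _ _ _ (is_series_deltaC 0 (RtoC 1)) X.
rewrite /is_pseries -[sqrt_sum w z](_ : Cplus (RtoC 1)
    (CSeries (fun i => CSeries (fun n => Cmult (f i n) (Cpow h n)))) = _).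
  apply: is_series_ext Y => n.
  change (Cplus (d n) (CSeries (fun i => Cmult (f i n) (Cpow h n))) =
    Cmult (Cpow h n) (Cplus (d n) (A n))).
  rewrite -[CSeries _](_ : Cmult (Cpow h n) (A n) = _).
    rewrite /d; case: eqP => [->|_]; last by ring.
    have -> : Cpow h 0 = RtoC 1 by [].
    by ring.
  by rewrite /A -CSeries_scal //; apply: CSeries_ext => i; rewrite Cmult_comm.
by rewrite /sqrt_sum; congr Cplus; apply: CSeries_ext => i; rewrite fE // zE.
Qed.

End SqrtSum.

(** * The minimum of Phi(t)/t *)

Section RealSqrtSum.
Variables (w : nat -> R) (K : R).
Hypotheses (wK : forall i, 0 <= w i <= K) (wS : ex_series w).

Definition root_term (t : R) (i : nat) : R := sqrt (1 + w i * (t * t)).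
Definition real_phi (t : R) : R := 1 + Series (fun i => (root_term t i - 1) / 2).
Definition real_dphi (t : R) : R := Series (fun i => w i * t / (2 * root_term t i)).
(** By [gapE] this is [2 (t Phi'(t) - Phi(t) + 1)], so the critical equation [Phi'(t) = Phi(t) / t]
    reads [real_gap t = 2]. *)
Definition real_gap (t : R) : R := Series (fun i => 1 - / root_term t i).

Lemma root_term_spec t i :
  1 <= root_term t i /\ root_term t i * root_term t i = 1 + w i * (t * t).
Proof.
have : 0 <= w i * (t * t) by have := wK i; nra.
move=> H; split; last by apply: sqrt_sqrt; lra.
by rewrite -{1}sqrt_1; apply: sqrt_le_1_alt; lra.
Qed.

Lemma root_term_inv t i : 0 < / root_term t i <= 1 /\ / root_term t i * root_term t i = 1.
Proof.
have [s1 _] := root_term_spec t i.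
split; last by field; lra.
split; first by apply: Rinv_0_lt_compat; lra.
by rewrite -[X in _ <= X]Rinv_1; apply: Rinv_le_contravar; lra.
Qed.

Lemma summable_phi t : ex_series (fun i => (root_term t i - 1) / 2).
Proof.
apply: ex_series_abs_le (ex_series_scal_l (K := R_AbsRing) (t * t) _ wS) => i.
rewrite /scal /= /mult /=; have [s1 s2] := root_term_spec t i.
by rewrite Rabs_pos_eq; nra.
Qed.

Lemma real_phi_ge1 t : 1 <= real_phi t.
Proof.
have : 0 <= Series (fun i => (root_term t i - 1) / 2).
  by apply: Series_ge0 (summable_phi t) => i; have [s1 _] := root_term_spec t i; lra.
by rewrite /real_phi; lra.
Qed.

Lemma summable_dphi t : 0 <= t -> ex_series (fun i => w i * t / (2 * root_term t i)).
Proof.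
move=> t0; apply: ex_series_abs_le (ex_series_scal_l (K := R_AbsRing) t _ wS) => i.
rewrite /scal /= /mult /=; have [s1 s2] := root_term_spec t i.
have wt : 0 <= w i * t by have := wK i; nra.
rewrite Rabs_pos_eq; last by apply: Rdiv_le_0_compat; lra.
by apply/Rle_div_l; [lra | nra].
Qed.

Lemma gap_term_bounds t i : 0 <= 1 - / root_term t i <= (t * t) * w i.
Proof.
have [s1 s2] := root_term_spec t i; have [[i0 i1] ii] := root_term_inv t i.
split; [lra | nra].
Qed.

Lemma summable_gap t : ex_series (fun i => 1 - / root_term t i).
Proof.
apply: ex_series_abs_le (ex_series_scal_l (K := R_AbsRing) (t * t) _ wS) => i.
by rewrite /scal /= /mult /= Rabs_pos_eq; have := gap_term_bounds t i; lra.
Qed.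

(** Termwise, with [s] the root and [w t^2 = s^2 - 1]: [(s^2 - 1) / (2 s) - (s - 1) / 2 = (1 - 1 /
    s) / 2]. *)
Lemma gapE t : 0 <= t -> t * real_dphi t - real_phi t = real_gap t / 2 - 1.
Proof.
move=> t0; rewrite /real_dphi /real_phi /real_gap.
suff -> : Series (fun i => 1 - / root_term t i) =
  2 * (t * Series (fun i => w i * t / (2 * root_term t i)) -
       Series (fun i => (root_term t i - 1) / 2)) by lra.
have S1 := summable_dphi t0.
rewrite -Series_scal_l -Series_minus; last exact: summable_phi.
  rewrite -Series_scal_l; apply: Series_ext => i.
  have [s1 s2] := root_term_spec t i.
  have -> : t * (w i * t / (2 * root_term t i)) =
      (root_term t i * root_term t i - 1) / (2 * root_term t i).
    by rewrite s2; field; lra.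
  by field; lra.
exact: (ex_series_scal_l (K := R_AbsRing)).
Qed.

Lemma real_gap_lt i0 s t : 0 < w i0 -> 0 <= s < t -> real_gap s < real_gap t.
Proof.
move=> w0 st.
have D i : 0 <= (1 - / root_term t i) - (1 - / root_term s i).
  have [s1 s2] := root_term_spec s i; have [t1 t2] := root_term_spec t i.
  have : root_term s i <= root_term t i.
    apply: sqrt_le_1_alt; apply: Rplus_le_compat_l.
    by apply: Rmult_le_compat_l; [case: (wK i) | nra].
  by move=> H; have := Rinv_le_contravar (root_term s i) (root_term t i) ltac:(lra) H; lra.
have D0 : 0 < (1 - / root_term t i0) - (1 - / root_term s i0).
  have [s1 s2] := root_term_spec s i0; have [t1 t2] := root_term_spec t i0.
  have H : root_term s i0 < root_term t i0.
    apply: sqrt_lt_1_alt; have : w i0 * (s * s) < w i0 * (t * t).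
      by apply: Rmult_lt_compat_l => //; nra.
    by have := wK i0; nra.
  by have := Rinv_lt_contravar (root_term s i0) (root_term t i0) ltac:(nra) H; lra.
have S := ex_series_minus _ _ (summable_gap t) (summable_gap s).
have := term_le_Series i0 D S; rewrite Series_minus; try exact: summable_gap.
by rewrite /real_gap; lra.
Qed.

(** All roots are at least 1, so in the difference of two terms the denominator left after
    rationalizing is at least 1. *)
Lemma real_gap_lipschitz s t :
  Rabs (real_gap t - real_gap s) <= Series w * Rabs (t * t - s * s).
Proof.
rewrite /real_gap -Series_minus; try exact: summable_gap.
rewrite Rmult_comm -Series_scal_l; apply: Series_abs_le; last first.
  exact: (ex_series_scal_l (K := R_AbsRing)).
move=> i; have [s1 s2] := root_term_spec s i; have [t1 t2] := root_term_spec t i.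
have -> : 1 - / root_term t i - (1 - / root_term s i) =
  (w i * (t * t - s * s)) * / (root_term t i * root_term s i * (root_term t i + root_term s i)).
  have -> : w i * (t * t - s * s) =
    (root_term t i - root_term s i) * (root_term t i + root_term s i) by nra.
  by field; lra.
rewrite !Rabs_mult (Rabs_pos_eq (w i)); last by have := wK i; lra.
have P : 1 <= root_term t i * root_term s i * (root_term t i + root_term s i).
  have : 1 <= root_term t i * root_term s i by nra.
  by nra.
rewrite (Rabs_pos_eq (/ _)); last by apply: Rlt_le; apply: Rinv_0_lt_compat; lra.
have I : / (root_term t i * root_term s i * (root_term t i + root_term s i)) <= 1.
  by rewrite -[X in _ <= X]Rinv_1; apply: Rinv_le_contravar; lra.
have := Rabs_pos (t * t - s * s); have := wK i.
set u := Rabs _; set v := / _ in I * => wi u0; have : 0 <= w i * u by nra.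
by nra.
Qed.

Lemma real_gap_continuous : continuity (fun t => real_gap t - 2).
Proof.
move=> t eps eps0; set W := Series w.
have W0 : 0 <= W by apply: Series_ge0 wS => i; case: (wK i).
have C0 : 0 < W * (2 * Rabs t + 1) + 1 by have := Rabs_pos t; nra.
exists (Rmin 1 (eps / (W * (2 * Rabs t + 1) + 1))); split.
  by apply: Rmin_pos; [lra | exact: Rdiv_lt_0_compat].
move=> s [_]; rewrite /= /R_dist => st.
have st1 := Rlt_le_trans _ _ _ st (Rmin_l _ _).
have st2 := Rlt_le_trans _ _ _ st (Rmin_r _ _).
have -> : real_gap s - 2 - (real_gap t - 2) = real_gap s - real_gap t by ring.
apply: Rle_lt_trans (real_gap_lipschitz _ _) _; rewrite -/W.
have -> : s * s - t * t = (s - t) * (s + t) by ring.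
rewrite Rabs_mult.
have B : Rabs (s + t) <= 2 * Rabs t + 1 by move: st1; split_Rabs; lra.
have d0 := Rabs_pos (s - t).
move: st2 => /(Rmult_lt_compat_r _ _ _ C0).
have -> : eps / (W * (2 * Rabs t + 1) + 1) * (W * (2 * Rabs t + 1) + 1) = eps by field; lra.
have : W * (Rabs (s - t) * Rabs (s + t)) <= Rabs (s - t) * (W * (2 * Rabs t + 1)).
  rewrite -Rmult_assoc [W * _]Rmult_comm Rmult_assoc; apply: Rmult_le_compat_l => //.
  exact: Rmult_le_compat_l.
by lra.
Qed.

(* Three positive weights (degree at least three) push the gap beyond [2]. *)
Lemma real_gap_root i1 i2 i3 : 0 < w i1 -> 0 < w i2 -> 0 < w i3 ->
  i1 <> i2 -> i1 <> i3 -> i2 <> i3 -> exists theta, 0 < theta /\ real_gap theta = 2.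
Proof.
move=> w1 w2 w3 n12 n13 n23.
pose mu := Rmin (w i1) (Rmin (w i2) (w i3)).
have mu0 : 0 < mu by repeat apply: Rmin_pos.
(* [T * T >= 9 / mu] makes each of the three roots at least [sqrt 10 > 3.1], so each term exceeds
   [0.67], and [3 * 0.67 > 2]. *)
pose T := 1 + 9 / mu.
have T9 : 0 < 9 / mu by apply: Rdiv_lt_0_compat; lra.
have big i : mu <= w i -> 67 / 100 <= 1 - / root_term T i.
  move=> mi; have [s1 s2] := root_term_spec T i; have [_ ii] := root_term_inv T i.
  have TT : 9 / mu <= T * T by rewrite /T; nra.
  have : 9 <= w i * (T * T).
    have -> : 9 = mu * (9 / mu) by field; lra.
    by apply: Rmult_le_compat; lra.
  move=> H; have s10 : 10 / 3 * 3 <= root_term T i * root_term T i by lra.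
  have s3 : 31 / 10 <= root_term T i by nra.
  by have [[j0 _] _] := root_term_inv T i; nra.
have m1 : mu <= w i1 := Rmin_l _ _.
have m2 : mu <= w i2 by apply: Rle_trans (Rmin_r _ _) (Rmin_l _ _).
have m3 : mu <= w i3 by apply: Rle_trans (Rmin_r _ _) (Rmin_r _ _).
have fT : 0 < real_gap T - 2.
  have D := is_series_plus _ _ _ _ (is_series_delta i1 (67 / 100))
    (is_series_plus _ _ _ _ (is_series_delta i2 (67 / 100)) (is_series_delta i3 (67 / 100))).
  have : Series (fun i => plus (if i == i1 then 67 / 100 else 0)
    (plus (if i == i2 then 67 / 100 else 0) (if i == i3 then 67 / 100 else 0))) <= real_gap T.
    apply: Series_mono (ex_intro _ _ D) (summable_gap T) => i; rewrite /plus /=.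
    case: eqP => [->|_].
      by move/eqP/negbTE: n12 => ->; move/eqP/negbTE: n13 => ->; have := big _ m1; lra.
    case: eqP => [->|_].
      by move/eqP/negbTE: n23 => ->; have := big _ m2; lra.
    case: eqP => [->|_]; first by have := big _ m3; lra.
    by have := gap_term_bounds T i; lra.
  by rewrite (is_series_unique _ _ D) /plus /=; lra.
have f0 : real_gap 0 = 0.
  rewrite /real_gap -[RHS]Series_const0; apply: Series_ext => i.
  by rewrite /root_term !Rmult_0_r Rplus_0_r sqrt_1 Rinv_1; lra.
have T0 : 0 < T by rewrite /T; lra.
have [z [[z0 zT] Hz]] := IVT _ 0 T real_gap_continuous T0 ltac:(lra) fT.
exists z; split; last lra.
by case: z0 Hz => // <-; rewrite f0; lra.
Qed.

Lemma real_phi_tangent theta t : 0 < theta -> 0 < t ->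
  real_phi theta + real_dphi theta * (t - theta) <= real_phi t.
Proof.
move=> th0 t0; rewrite /real_phi /real_dphi.
have S1 := summable_phi theta; have S2 := summable_phi t.
have S3 := summable_dphi (Rlt_le _ _ th0).
have S4 : ex_series (fun i => (t - theta) * (w i * theta / (2 * root_term theta i))).
  exact: (ex_series_scal_l (K := R_AbsRing)).
have := Series_mono (a := fun i => (root_term theta i - 1) / 2 +
   (t - theta) * (w i * theta / (2 * root_term theta i)))
  (b := fun i => (root_term t i - 1) / 2) _ (ex_series_plus _ _ S1 S4) S2.
rewrite Series_plus // Series_scal_l => H; suff : forall i : nat,
  (root_term theta i - 1) / 2 + (t - theta) * (w i * theta / (2 * root_term theta i)) <=
  (root_term t i - 1) / 2 by move/H; lra.
move=> i; have [s1 s2] := root_term_spec theta i; have [t1 t2] := root_term_spec t i.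
set s := root_term theta i in s1 s2 *; set u := root_term t i in t1 t2 *.
have wi := wK i.
(* Cauchy-Schwarz for the vectors [(1, sqrt w theta)] and [(1, sqrt w t)] *)
have CS : 1 + w i * (theta * t) <= s * u.
  apply: Rsqr_incr_0_var; last by nra.
  rewrite /Rsqr.
  have -> : s * u * (s * u) = (s * s) * (u * u) by ring.
  rewrite s2 t2; have : 0 <= w i * ((theta - t) * (theta - t)).
    by apply: Rmult_le_pos; [lra | exact: Rle_0_sqr].
  by lra.
have -> : (s - 1) / 2 + (t - theta) * (w i * theta / (2 * s)) =
  ((s * s + w i * (theta * t) - w i * (theta * theta)) / s - 1) / 2 by field; lra.
have -> : s * s + w i * (theta * t) - w i * (theta * theta) = 1 + w i * (theta * t) by lra.
have : (1 + w i * (theta * t)) / s <= u by apply/Rle_div_l; lra.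
by lra.
Qed.

Lemma sqrt_sum_RtoC t : sqrt_sum w (RtoC t) = RtoC (real_phi t).
Proof.
rewrite /real_phi RtoC_plus -CSeries_RtoC; congr Cplus; apply: CSeries_ext => i.
have [s1 s2] := root_term_spec t i.
have -> : quad_at (w i) (RtoC t) = RtoC (1 + w i * (t * t)).
  by rewrite /quad_at -!RtoC_mult -RtoC_plus.
rewrite Csqrt_pos -/(root_term t i); last by rewrite -s2; nra.
by rewrite -RtoC_minus -RtoC_mult; congr RtoC; lra.
Qed.

Lemma sqrt_sum_derive t : 0 < t ->
  is_derive (K := C_AbsRing) (V := C_NormedModule) (sqrt_sum w) (RtoC t)
    (RtoC (real_dphi t)).
Proof.
move=> t0.
(* At a real point the radicand is at least 1, so [delta = 2] works. *)
have [|r [M [a [H Ha]]]] := @sqrt_sum_pseries w K wK wS (RtoC t) 2 ltac:(lra).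
  move=> x xK; rewrite /quad_at -!RtoC_mult -RtoC_plus Cmod_R /=.
  by rewrite Rabs_pos_eq; nra.
have := has_pseries_derive H; rewrite Ha.
rewrite (_ : CSeries _ = RtoC (real_dphi t)) //.
rewrite -CSeries_RtoC; apply: CSeries_ext => i.
have [s1 s2] := root_term_spec t i.
have -> : quad_at (w i) (RtoC t) = RtoC (1 + w i * (t * t)).
  by rewrite /quad_at -!RtoC_mult -RtoC_plus.
rewrite Csqrt_pos -/(root_term t i); last by rewrite -s2; nra.
rewrite -RtoC_mult -RtoC_div; last lra.
by congr RtoC; field; lra.
Qed.

End RealSqrtSum.

(** [|q| + Re q] vanishes only on the cut of the square root, and [1 + x z^2] lies there only for
    imaginary [z] with [x |z|^2 >= 1], that is [|z| >= 1 / K]. Continuity in [x] on the compact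
    interval makes the positivity uniform. *)
Lemma quad_at_away (K : R) (z : C) : 0 < K ->
  ~ (exists t, / K <= t /\ (z = (0, t) \/ z = (0, - t))) ->
  exists delta, 0 < delta /\ forall x, 0 <= x <= K * K ->
    delta <= Cmod (quad_at x z) + Re (quad_at x z).
Proof.
move=> K0 nz; pose f x := Cmod (quad_at x z) + Re (quad_at x z).
have fpos x : 0 <= x <= K * K -> 0 < f x.
  move=> xK; rewrite /f; apply: Rnot_le_lt => H; apply: nz.
  have := re_le_Cmod (quad_at x z); have := Cmod2_alt (quad_at x z).
  have := Cmod_ge_0 (quad_at x z).
  set M := Cmod _ in H *; case: (z) H => a b /= H M0 E1 E2.
  have {E2}E2 : M = - (1 + (x * (a * a - b * b) - 0 * (a * b + b * a))).
    by move: E2; split_Rabs; lra.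
  have I0 : x * (a * b) = 0 by nra.
  have R0 : 1 + x * (a * a - b * b) <= 0 by lra.
  have b0 : b <> 0 by move=> b0; rewrite b0 in R0; nra.
  have x0 : x <> 0 by move=> x0; rewrite x0 in R0; lra.
  have a0 : a = 0.
    case: (Rmult_integral _ _ I0) => [E|ab]; first by case: (x0 E).
    by case: (Rmult_integral _ _ ab).
  rewrite a0 in R0 *.
  have Kb : 1 <= K * Rabs b.
    have : 1 <= (K * Rabs b) * (K * Rabs b).
      have -> : (K * Rabs b) * (K * Rabs b) = (K * K) * (b * b).
        by have := Rsqr_abs b; rewrite /Rsqr => E; rewrite E; ring.
      have : x * (b * b) <= K * K * (b * b).
        by apply: Rmult_le_compat_r; [exact: Rle_0_sqr | lra].
      by lra.
    have : 0 <= K * Rabs b by apply: Rmult_le_pos; [lra | exact: Rabs_pos].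
    by nra.
  exists (Rabs b); split.
    by apply: (Rmult_le_reg_l K) => //; rewrite Rinv_r; lra.
  by split_Rabs; [right | left]; congr pair; lra.
have fcont x : continuity_pt f x.
  move=> eps eps0; set Z := Cmod (Cmult z z); have Z0 : 0 <= Z := Cmod_ge_0 _.
  exists (eps / (2 * Z + 1)); split; first by apply: Rdiv_lt_0_compat; lra.
  move=> y [_]; rewrite /= /R_dist => /(Rmult_lt_compat_r (2 * Z + 1) _ _ ltac:(lra)).
  have -> : eps / (2 * Z + 1) * (2 * Z + 1) = eps by field; lra.
  (* Modulus and real part each change by at most [|u - v| |z|^2]. *)
  have L u v : f u <= f v + 2 * (Rabs (u - v) * Z).
    have D : quad_at u z = Cplus (quad_at v z) (Cmult (RtoC (u - v)) (Cmult z z)).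
      by rewrite /quad_at RtoC_minus; ring.
    have := Cmod_triangle (quad_at v z) (Cmult (RtoC (u - v)) (Cmult z z)).
    have := re_le_Cmod (Cmult (RtoC (u - v)) (Cmult z z)).
    have -> : Cmod (Cmult (RtoC (u - v)) (Cmult z z)) = Rabs (u - v) * Z.
      by rewrite Cmod_mult Cmod_R.
    rewrite -D /f.
    have -> : Re (quad_at u z) = Re (quad_at v z) + Re (Cmult (RtoC (u - v)) (Cmult z z)).
      by rewrite D.
    by set X := Re (Cmult _ _); split_Rabs; lra.
  have := L x y; have := L y x; rewrite (Rabs_minus_sym x y).
  have := Rabs_pos (y - x); have : 0 <= Rabs (y - x) * Z by have := Rabs_pos (y - x); nra.
  by move=> *; split_Rabs; lra.
have [x0 [Hmin x0K]] := continuity_ab_min f 0 (K * K) ltac:(nra) (fun x _ => fcont x).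
by exists (f x0); split; [exact: fpos | move=> x /Hmin].
Qed.

(** * The sum over neighbours as a weighted sum over indices *)

Section OrbitSum.
Variables (V : countType) (adj : rel V) (p : V -> V -> R) (o : V).
Hypotheses (stoch : nn_stochastic adj p).

Definition edge_weight : nat -> R := enum_term (fun y => 4 * p o y * p y o).

Lemma edge_weight_summable : ex_series edge_weight.
Proof.
apply: (summable_le (g := fun y => 4 * p o y)).
  move=> y; have := p_ge0 stoch o y; have := p_ge0 stoch y o; have := p_le1 stoch y o.
  by move=> *; rewrite Rabs_pos_eq; nra.
exact: summable_scal (summable_p stoch o).
Qed.

Lemma edge_weight_bound kappa :
  (forall y, adj o y -> 2 * sqrt (p o y * p y o) <= kappa) -> 0 < kappa ->
  forall i, 0 <= edge_weight i <= kappa * kappa.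
Proof.
move=> H k0 i; rewrite /edge_weight /enum_term; case: pickle_inv => [y|]; last by nra.
have a0 := p_ge0 stoch o y; have b0 := p_ge0 stoch y o.
have ab : 0 <= p o y * p y o by exact: Rmult_le_pos.
split; first by lra.
case oy: (adj o y); last by rewrite (p_eq0 stoch (negbT oy)); nra.
have := H y oy; have := sqrt_sqrt _ ab; have := sqrt_pos (p o y * p y o).
set s := sqrt _ => s0 s2 sk; nra.
Qed.

Lemma Phi_sqrt_sum z : Phi adj p o z = sqrt_sum edge_weight z.
Proof.
congr Cplus; apply: CSeries_ext => i.
rewrite /enum_termC /edge_weight /enum_term.
(* Weight 0 gives the term 0; this absorbs both the non-neighbours of [o] and the indices that code
   no vertex. *)
have Z : RtoC 0 = Cmult (RtoC (/ 2)) (Cminus (Csqrt (quad_at 0 z)) (RtoC 1)).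
  have -> : quad_at 0 z = RtoC 1 by rewrite /quad_at Cmult_0_l Cplus_0_r.
  by rewrite Csqrt_pos ?sqrt_1; [ring | lra].
case: pickle_inv => [y|] //; case: ifP => // oy.
by rewrite (p_eq0 stoch (negbT oy)) Rmult_0_r Rmult_0_l.
Qed.

End OrbitSum.

Theorem theorem5p2 (V : countType) (adj : rel V) (p : V -> V -> R)
    (Gam : (V -> V) -> Prop) (o : V) (kappa : R) :
  is_tree adj -> min_degree3 adj -> nn_stochastic adj p ->
  aut_subgroup adj Gam -> vertex_transitive Gam -> p_invariant Gam p ->
  (* sum_{j in I} d_j p_{-j} < oo *)
  ex_series (enum_term (fun y => if adj o y then p y o else 0)) ->
  (* kappa = max { 2 sqrt(p_j p_{-j}) : j in I } *)
  (exists y, adj o y /\ kappa = 2 * sqrt (p o y * p y o)) ->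
  (forall y, adj o y -> 2 * sqrt (p o y * p y o) <= kappa) ->
  let rho := spec_rad p o in
  let F := Phi adj p o in
  let U := fun l : C => rho < Cmod l /\
        ~ (exists t, rho < t <= kappa /\ (l = (0, t) \/ l = (0, - t))) in
  let W := fun z : C =>
        ~ (exists t, / kappa <= t /\ (z = (0, t) \/ z = (0, - t))) in
  analytic_on W F /\
  (forall l, U l -> exists g : C,
      is_series (K := C_AbsRing) (V := C_NormedModule) (Gterm p o l) g /\
      Cmult l g = F g) /\
  (exists theta, 0 < theta /\
     is_derive (K := C_AbsRing) (V := C_NormedModule) F (RtoC theta)
               (Cdiv (F (RtoC theta)) (RtoC theta)) /\
     (forall t l, 0 < t ->
        is_derive (K := C_AbsRing) (V := C_NormedModule) F (RtoC t) l ->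
        l = Cdiv (F (RtoC t)) (RtoC t) -> t = theta) /\
     RtoC rho = Cdiv (F (RtoC theta)) (RtoC theta) /\
     (forall t, 0 < t -> Im (F (RtoC t)) = 0 /\ rho <= Re (F (RtoC t)) / t)).
Proof.
move=> tree deg stoch aut trans inv _ kmax kle rho F U W.
have pos y : adj o y -> 0 < p o y * p y o.
  move=> oy; apply: Rmult_lt_0_compat; apply: (p_gt0 stoch) => //.
  by rewrite (adj_sym tree).
have k0 : 0 < kappa.
  have [y [oy ->]] := kmax; have := sqrt_lt_R0 _ (pos y oy); lra.
pose w := edge_weight p o.
have wK : forall i, 0 <= w i <= kappa * kappa := edge_weight_bound stoch kle k0.
have wS : ex_series w := edge_weight_summable o stoch.
have FE z : F z = sqrt_sum w z := Phi_sqrt_sum o stoch z.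
have diag n x : pn p n x x = pn p n o o := pn_diag stoch aut trans inv n x o.
have [_ rho0] := spec_rad_LimSup o stoch; rewrite -/rho in rho0.
have FR t : F (RtoC t) = RtoC (real_phi w t) by rewrite FE (sqrt_sum_RtoC wK).
split.
  move=> z0 Wz0; have [d [d0 away]] := quad_at_away k0 Wz0.
  have [r [M [a [[r0 _ H] _]]]] := sqrt_sum_pseries wK wS d0 away.
  by exists r; split=> //; exists a => z /H; rewrite FE.
have green r z : rho < r -> Cmod z = / r ->
    Cabs_summable (gterm (fun n => pn p n o o) z) /\
    gf (fun n => pn p n o o) z = F (Cmult z (gf (fun n => pn p n o o) z)).
  move=> rr zr; have r0 : 0 < / r by apply: Rinv_0_lt_compat; lra.
  have conv := spec_rad_conv stoch rr.
  split; first exact: (ret_conv stoch diag conv o zr).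
  exact: (gf_Phi tree stoch diag r0 conv o zr).
split.
  move=> l [lr _]; have l0 : l <> RtoC 0 by apply/Cmod_gt_0; lra.
  have [S E] := green _ (Cinv l) lr (Cmod_inv _ l0).
  (* [G(l) = a(1/l) / l], so [l G] is the generating function at [1/l] and [G] is the argument of
     Phi in [gf_Phi]. *)
  exists (Cmult (Cinv l) (gf (fun n => pn p n o o) (Cinv l))); split; last first.
    by rewrite -E; field.
  have H := is_series_scal_l (K := C_AbsRing) (V := C_NormedModule) (Cinv l) _ _
    (CSeries_correct S).
  apply: is_series_ext H => n; rewrite /gterm /Gterm.
  change (Cmult (Cinv l) (Cmult (RtoC (pn p n o o)) (Cpow (Cinv l) n)) =
    Cdiv (RtoC (pn p n o o)) (Cmult l (Cpow l n))).
  have ln m : Cpow l m <> RtoC 0 /\ Cpow (Cinv l) m = Cinv (Cpow l m) :> C.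
    elim: m => [|m [IH1 IH2]].
      by split; [exact: C1_nz | change (RtoC 1 = Cinv (RtoC 1)); field].
    rewrite !Cpow_S IH2; split; first exact: Cmult_neq_0.
    by field.
  by rewrite (proj2 (ln n)); field; split=> //; case: (ln n).
have [y1 [y2 [y3 [o1 o2 o3 [n12 n13 n23]]]]] := deg o.
have wpos y : adj o y -> 0 < w (pickle y).
  by move=> /pos; rewrite /w /edge_weight enum_term_pickle; lra.
have pinj (x y : V) : x <> y -> pickle x <> pickle y.
  by move=> xy /(pcan_inj pickleK_inv).
have [theta [th0 gap2]] := real_gap_root wK wS (wpos _ o1) (wpos _ o2) (wpos _ o3)
  (pinj _ _ n12) (pinj _ _ n13) (pinj _ _ n23).
have der t : 0 < t -> is_derive (K := C_AbsRing) (V := C_NormedModule) F (RtoC t)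
    (RtoC (real_dphi w t)).
  move=> t0; apply: is_derive_ext (sqrt_sum_derive wK wS t0) => z.
  by rewrite -FE.
have dth : real_dphi w theta = real_phi w theta / theta.
  have := gapE wK wS (Rlt_le _ _ th0); rewrite gap2 => E.
  by apply: (Rmult_eq_reg_l theta); [field_simplify; lra | lra].
have below t : 0 < t -> rho <= real_phi w t / t.
  move=> t0.
  have E : real_phi w t = 1 + vsum (edge_root p t o).
    congr Rplus; apply: Series_ext => i; rewrite /root_term /w /edge_weight /enum_term.
    case: pickle_inv => // .
    by rewrite Rmult_0_l Rplus_0_r sqrt_1; lra.
  apply: (spec_rad_le stoch).
    by apply: Rdiv_le_0_compat => //; have := real_phi_ge1 wK wS t; lra.
  by rewrite E; exact: (ret_le_pow tree stoch aut trans inv).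
exists theta; split=> //; split.
  by rewrite FR -RtoC_div; [rewrite -dth; exact: der | lra].
split.
  move=> t l t0 dl El.
  have : l = RtoC (real_dphi w t).
    by rewrite -(is_C_derive_unique _ _ _ dl) -(is_C_derive_unique _ _ _ (der t t0)).
  rewrite El FR -RtoC_div; last lra.
  move=> /RtoC_inj E.
  have := gapE wK wS (Rlt_le _ _ t0); rewrite -E.
  have -> : t * (real_phi w t / t) = real_phi w t by field; lra.
  (* Any critical point has gap 2, and the gap is strictly increasing. *)
  move=> G; have gt : real_gap w t = 2 by lra.
  have w1 := wpos _ o1.
  case: (Rtotal_order t theta) => [lt|[//|lt]].
    by have := real_gap_lt wK wS w1 (conj (Rlt_le _ _ t0) lt); lra.
  by have := real_gap_lt wK wS w1 (conj (Rlt_le _ _ th0) lt); lra.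
split; last by move=> t t0; rewrite FR /=; split=> //; exact: below.
rewrite FR -RtoC_div; last lra.
congr RtoC; apply: Rle_antisym; first exact: below.
set r0 := real_phi w theta / theta.
(* For r > rho the point t = G(r) satisfies Phi(t)/t = r. *)
suff above r : rho < r -> r0 <= r.
  by apply: Rnot_lt_le => lt; have := above ((rho + r0) / 2) ltac:(lra); lra.
move=> rr; have ri : 0 < / r by apply: Rinv_0_lt_compat; lra.
have zr : Cmod (RtoC (/ r)) = / r by rewrite Cmod_R Rabs_pos_eq; lra.
have [S E] := green _ _ rr zr.
move: E; rewrite gf_RtoC; set al := Series _.
(* The term of length 0 is 1; hence [t = G(r)] is positive. *)
have al1 : 1 <= al.
  have H n : 0 <= pn p n o o * (/ r) ^ n.
    apply: Rmult_le_pos; first by case: (pn_bounds stoch n o o).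
    by apply: pow_le; lra.
  have := term_le_Series 0 H (spec_rad_conv stoch rr).
  by rewrite /= eqxx Rmult_1_l.
rewrite -RtoC_mult FR => /RtoC_inj E.
have t0 : 0 < / r * al by nra.
(* As [Phi'(theta) = Phi(theta) / theta = r0], the tangent at theta passes through the origin, so
   the inequality says [r0 * t <= Phi(t)], and [Phi(t) = al = r * t] at [t = al / r]. *)
have := real_phi_tangent wK wS th0 t0; rewrite -E dth -/r0.
have -> : real_phi w theta = r0 * theta by rewrite /r0; field; lra.
move=> H; have {}H : r0 * (/ r * al) <= al by lra.
apply: (Rmult_le_reg_r (/ r * al)) => //.
by have -> : r * (/ r * al) = al by field; lra.
Qed.
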